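(* Let $q$ be a prime power and let $\mathbb{F}_q$ be the field with $q$ elements. For $n\ge 1$ let $p_n$ be the number of $\mathbb{F}_q$-automorphisms $\varphi=(f,g)$ of the polynomial algebra $\mathbb{F}_q[x,y]$ of degree $n$, i.e. such that $\max\{\deg(f),\deg(g)\}=n$. (i) The numbers $p_n$ are given by \[ p_1=q^3(q-1)^2(q+1), \] \[ p_n=(q(q-1)(q+1))^2\sum \left(\frac{q-1}{q}\right)^k q^{n_1+\cdots+n_k},\qquad n>1, \] where the summation is over all ordered factorizations $n=n_1\cdots n_k$ of $n$ with $n_1,\ldots,n_k>1$ (over all possible lengths $k\ge 1$). (ii) The Dirichlet series generating function $p(s)$ of the sequence $p_n$, $n=1,2,\ldots$, is \[ p(s)=\sum_{n\geq 1}\frac{p_n}{n^s} =(q(q-1)(q+1))^2\left(\frac{1}{1-\frac{q-1}{q}\rho(s)}-\frac{1}{q+1}\right), \] where \[ \rho(s)=\sum_{n\geq 2}\frac{q^n}{n^s}. \]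
   Context: An automorphism $\varphi$ of $\mathbb{F}_q[x,y]$ is written $\varphi=(f,g)$, meaning $f=\varphi(x)$, $g=\varphi(y)$; all automorphisms are $\mathbb{F}_q$-algebra automorphisms. Here $\deg$ is the total degree, and the degree of $\varphi$ is $\deg(\varphi)=\max\{\deg(f),\deg(g)\}$. Dirichlet series are formal: $\sum_{n\ge1}a_n n^{-s}$ encodes the sequence $(a_n)_{n\ge1}$ of rational numbers, addition is coefficientwise, and multiplication is Dirichlet convolution (the coefficient at $n$ of a product is $\sum_{ij=n}a_ib_j$). A constant $c$ denotes the series with coefficient $c$ at $n=1$ and $0$ elsewhere. Since $\rho(s)$ has zero coefficient at $n=1$, the series $1-\frac{q-1}{q}\rho(s)$ is invertible in this ring. No convergence is claimed. *)

(* Defs.v *)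
From HB Require Import structures.
From mathcomp Require Import all_boot all_order all_algebra.
From mathcomp Require Import finmap mpoly.
From mathcomp Require Import boolp classical_sets functions cardinality fsbigop.

Set Implicit Arguments.
Unset Strict Implicit.
Unset Printing Implicit Defensive.

Import Order.TTheory GRing.Theory Num.Theory.
Local Open Scope classical_set_scope.
Local Open Scope ring_scope.

(** * Automorphisms of the polynomial algebra in two variables *)

Section Automorphisms.
Variable F : finFieldType.

(* [msize] is one more than the total degree; the zero polynomial, which is
   never the image of a variable under an automorphism, gets degree 0. *)
Definition tdeg (f : {mpoly F[2]}) : nat := (msize f).-1.

Definition alg_auto (phi : {mpoly F[2]} -> {mpoly F[2]}) : Prop :=
  [/\ linear phi, monoid_morphism phi & bijective phi].

Definition auto_deg (phi : {mpoly F[2]} -> {mpoly F[2]}) : nat :=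
  maxn (tdeg (phi 'X_ord0)) (tdeg (phi 'X_ord_max)).

(* [fset_set] sends infinite sets to the empty set, so a positive value
   of [num_auto n] entails that the set is finite. *)
Definition num_auto (n : nat) : nat :=
  #|` fset_set [set phi | alg_auto phi /\ auto_deg phi = n] |%fset.

End Automorphisms.

Definition ordered_factorizations (n : nat) : set (seq nat) :=
  [set s | [/\ s != [::], all (fun m => 1 < m)%N s
             & (\prod_(m <- s) m)%N = n]].

(** * The ring of formal Dirichlet series with rational coefficients *)

(* A sequence is indexed by the positive integers; the junk coefficient at 0
   is forced to vanish, so that equality of series is equality of the
   coefficients at all n >= 1. *)
Record dirichlet := Dirichlet { dcoef :> nat -> rat; _ : dcoef 0%N == 0 }.

HB.instance Definition _ := [isSub for dcoef].
HB.instance Definition _ := [Choice of dirichlet by <:].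

Lemma dcoef0 (a : dirichlet) : a 0%N = 0.
Proof. by case: a => a /= /eqP. Qed.

Definition dseries_fun (a : nat -> rat) (n : nat) : rat :=
  if n is 0%N then 0 else a n.

Lemma dseries_subproof a : dseries_fun a 0%N == 0.
Proof. exact: eqxx. Qed.

(* The formal series \sum_(n >= 1) a n / n ^ s. *)
Definition dseries (a : nat -> rat) : dirichlet :=
  Dirichlet (dseries_subproof a).

Lemma dseriesE a n : (0 < n)%N -> dseries a n = a n.
Proof. by case: n. Qed.

Lemma dirichletP (a b : dirichlet) :
  (forall n, (0 < n)%N -> a n = b n) <-> a = b.
Proof.
split=> [eq_ab|-> //]; apply/val_inj/funext => -[|n]; last exact: eq_ab.
by rewrite /= !dcoef0.
Qed.

Definition dconst (c : rat) : dirichlet :=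
  dseries (fun n => if n == 1%N then c else 0).

Definition dadd (a b : dirichlet) : dirichlet :=
  dseries (fun n => a n + b n).

Definition dopp (a : dirichlet) : dirichlet :=
  dseries (fun n => - a n).

Definition dconv (a b : nat -> rat) (n : nat) : rat :=
  \sum_(i < n.+1) \sum_(j < n.+1 | (i * j == n)%N) a i * b j.

Definition dmul (a b : dirichlet) : dirichlet := dseries (dconv a b).

Lemma daddE (a b : dirichlet) n : dadd a b n = a n + b n.
Proof. by case: n => [|n] //=; rewrite !dcoef0 addr0. Qed.

Fact daddA : associative dadd.
Proof. by move=> a b c; apply/dirichletP => n _; rewrite !daddE addrA. Qed.

Fact daddC : commutative dadd.
Proof. by move=> a b; apply/dirichletP => n _; rewrite !daddE addrC. Qed.

Fact dadd0 : left_id (dconst 0) dadd.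
Proof.
move=> a; apply/dirichletP => n n0; rewrite daddE dseriesE //.
by rewrite if_same add0r.
Qed.

Fact daddN : left_inverse (dconst 0) dopp dadd.
Proof.
move=> a; apply/dirichletP => n n0; rewrite daddE !dseriesE //.
by rewrite if_same addNr.
Qed.

HB.instance Definition _ :=
  GRing.isZmodule.Build dirichlet daddA daddC dadd0 daddN.

Lemma dconv_widen (a b : nat -> rat) N n : (0 < n)%N -> (n <= N)%N ->
  dconv a b n =
  \sum_(i < N.+1) \sum_(j < N.+1 | (i * j == n)%N) a i * b j.
Proof.
move=> n0 leN.
rewrite /dconv (big_ord_widen _ (fun i =>
  \sum_(j < n.+1 | (i * j == n)%N) a i * b j) (leN : (n < N.+1)%N)).
rewrite big_mkcond; apply: eq_bigr => i _.
rewrite (big_ord_widen_cond _ (fun j => (i * j == n)%N)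
  (fun j => a i * b j) (leN : (n < N.+1)%N)).
case: ltnP => [_|lti].
  apply: eq_bigl => j; case: eqP => //= ijn; rewrite ltnS -ijn leq_pmull //.
  by rewrite lt0n; apply: contraTneq n0 => i0; rewrite -ijn i0 mul0n.
rewrite big1// => j /eqP ijn; suff: (i <= n)%N by rewrite leqNgt lti.
rewrite -ijn leq_pmulr// lt0n; apply: contraTneq n0 => j0.
by rewrite -ijn j0 muln0.
Qed.

Lemma dmulE (a b : dirichlet) n : (0 < n)%N -> dmul a b n =
  \sum_(i < n.+1) \sum_(j < n.+1 | (i * j == n)%N) a i * b j.
Proof. by move=> n0; rewrite dseriesE. Qed.

Fact dmulC : commutative dmul.
Proof.
move=> a b; apply/dirichletP => n n0; rewrite !dmulE // [RHS](exchange_big_dep xpredT) //=.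
by apply: eq_bigr => i _; apply: eq_big => [j|j _]; rewrite (mulnC, mulrC).
Qed.

Lemma dmul_triple (a b c : dirichlet) n : (0 < n)%N ->
  dmul a (dmul b c) n =
  \sum_(i < n.+1) \sum_(j < n.+1) \sum_(k < n.+1 | (i * (j * k) == n)%N)
     a i * (b j * c k).
Proof.
move=> n0; rewrite dmulE //; apply: eq_bigr => i _.
transitivity (\sum_(m < n.+1 | (i * m == n)%N)
   \sum_(j < n.+1) \sum_(k < n.+1 | (j * k == m)%N) a i * (b j * c k)).
  apply: eq_bigr => m /eqP imn.
  have m0 : (0 < m)%N.
    by rewrite lt0n; apply: contraTneq n0 => m0; rewrite -imn m0 muln0.
  rewrite dseriesE // (@dconv_widen b c n m) //; last by rewrite -ltnS.
  rewrite big_distrr /=; apply: eq_bigr => j _.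
  by rewrite big_distrr.
rewrite exchange_big /=; apply: eq_bigr => j _.
rewrite (exchange_big_dep (fun k : 'I_n.+1 => i * (j * k) == n)%N) /=; last first.
  by move=> m k /eqP imn /eqP jkm; rewrite jkm imn.
apply: eq_bigr => k /eqP ijk.
have jkn : (j * k < n.+1)%N.
  have i0 : (0 < i)%N.
    by rewrite lt0n; apply: contraTneq n0 => i0; rewrite -ijk i0 mul0n.
  by rewrite ltnS; have := leq_pmull (j * k) i0; rewrite ijk.
rewrite (big_pred1 (Ordinal jkn)) // => m /=.
apply/andP/eqP => [[_ /eqP jkm]|->]; first exact/val_inj.
by rewrite /= ijk !eqxx.
Qed.

Fact dmulA : associative dmul.
Proof.
move=> a b c; rewrite [RHS]dmulC; apply/dirichletP => n n0.
rewrite !dmul_triple //.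
under eq_bigr do under eq_bigr do rewrite big_mkcond.
under [RHS]eq_bigr do under eq_bigr do rewrite big_mkcond.
rewrite /= [RHS]exchange_big /=; apply: eq_bigr => i _.
rewrite [RHS]exchange_big /=; apply: eq_bigr => j _; apply: eq_bigr => k _.
by rewrite mulnA (mulnC (i * j)%N) mulrA (mulrC (a i * b j)).
Qed.

Fact dmul1 : left_id (dconst 1) dmul.
Proof.
move=> a; apply/dirichletP => -[//|n] n0; rewrite dmulE //.
rewrite 2!big_ord_recl /= big1 ?add0r; last first.
  by move=> j _; rewrite mul0r.
rewrite [X in _ + X]big1 ?addr0; last first.
  by move=> i _; rewrite big1 // => j _; rewrite mul0r.
rewrite (big_pred1 ord_max) /= ?mul1r // => j.
by rewrite mul1n.
Qed.

Fact dmulDl : left_distributive dmul dadd.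
Proof.
move=> a b c; apply/dirichletP => n n0; rewrite daddE !dmulE // -big_split.
apply: eq_bigr => i _; rewrite -big_split; apply: eq_bigr => j _.
by rewrite daddE mulrDl.
Qed.

Fact dconst1_neq0 : dconst 1 != dconst 0.
Proof. by apply/eqP => /(congr1 (fun a : dirichlet => a 1%N)). Qed.

HB.instance Definition _ := GRing.Zmodule_isComNzRing.Build dirichlet
  dmulA dmulC dmul1 dmulDl dconst1_neq0.

(* The inverse of a series with nonzero coefficient at 1, computed from
     a_1 b_n = - \sum_(i * j = n, j < n) a_i b_j   for n > 1;
   [m] is fuel, and every m >= n gives the same value. *)
Fixpoint dinv_rec (a : nat -> rat) (m n : nat) : rat :=
  if m is m'.+1 then
    if n == 1%N then (a 1%N)^-1 else
    - (a 1%N)^-1 * \sum_(i < n.+1)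
        \sum_(j < n | (i * j == n)%N) a i * dinv_rec a m' j
  else 0.

Definition dunit : pred dirichlet := fun a => a 1%N != 0.

Definition dinv (a : dirichlet) : dirichlet :=
  if dunit a then dseries (fun n => dinv_rec a n n) else a.

Lemma dinv_rec_fuel a m m' n : (n <= m)%N -> (n <= m')%N ->
  dinv_rec a m n = dinv_rec a m' n.
Proof.
elim: m m' n => [|m IHm] [|m'] n //=.
- rewrite leqn0 => /eqP -> _ /=.
  by rewrite big1 ?mulr0 // => i _; rewrite big_ord0.
- move=> _; rewrite leqn0 => /eqP -> /=.
  by rewrite big1 ?mulr0 // => i _; rewrite big_ord0.
move=> len len'; case: eqP => // _; congr (_ * _).
apply: eq_bigr => i _; apply: eq_bigr => j _; congr (_ * _).
by apply: IHm; rewrite -ltnS; apply: leq_trans (ltn_ord j) _.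
Qed.

Lemma dmul1coef (a b : dirichlet) : dmul a b 1%N = a 1%N * b 1%N.
Proof.
rewrite dmulE // 2!big_ord_recl big_ord0 /= addr0 big1 ?add0r; last first.
  by move=> j _; rewrite dcoef0 mul0r.
change (bump 0 0) with 1%N; rewrite (big_pred1 ord_max) // => j.
by rewrite mul1n.
Qed.

Fact dmulV : {in dunit, left_inverse (dconst 1) dinv dmul}.
Proof.
move=> a; rewrite unfold_in /= => ua; rewrite dmulC; apply/dirichletP => n n0.
rewrite /dinv /dunit ua; have [->|n1] := eqVneq n 1%N.
  by rewrite dmul1coef /= divff.
rewrite [RHS]dseriesE // (negPf n1) dmulE //.
under eq_bigr do rewrite big_mkcond big_ord_recr /= -big_mkcond /=.
rewrite big_split /=.
set b := fun j => dinv_rec a j j.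
have -> : \sum_(i < n.+1) (if (i * n == n)%N then a i * dseries b n else 0)
   = a 1%N * dinv_rec a n n.
  rewrite -big_mkcond (big_pred1 (Ordinal (n0 : (1 < n.+1)%N))) ?dseriesE //.
  by move=> i; rewrite -[RHS](inj_eq val_inj) -[RHS](eqn_pmul2r n0) mul1n.
case: n n0 n1 => // n n0 n1; rewrite [dinv_rec _ _ _]/= (negPf n1).
rewrite mulNr mulrN mulrA divff // mul1r.
apply/eqP; rewrite subr_eq0; apply/eqP.
apply: eq_bigr => i _; apply: eq_bigr => j /eqP ij; congr (_ * _).
have j0 : (0 < j)%N.
  by rewrite lt0n; apply: contraTneq n0 => j0; rewrite -ij j0 muln0.
rewrite -[LHS]/(dseries b j) dseriesE //.
by apply: dinv_rec_fuel => //; rewrite -ltnS.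
Qed.

Fact dunitPl : forall a b : dirichlet, dmul b a = dconst 1 -> dunit a.
Proof.
move=> a b /(congr1 (fun c : dirichlet => c 1%N)); rewrite dmul1coef /= => ba.
apply/negP => /eqP a0; move: ba; rewrite a0 mulr0 => /eqP.
by rewrite eq_sym oner_eq0.
Qed.

Fact dinv_out : {in [predC dunit], dinv =1 id}.
Proof. by move=> a; rewrite inE /= unfold_in /dinv /dunit => /negPf ->. Qed.

HB.instance Definition _ := GRing.ComNzRing_hasMulInverse.Build dirichlet
  dmulV dunitPl dinv_out.

Definition p_series (F : finFieldType) : dirichlet :=
  dseries (fun n => (num_auto F n)%:R).

Definition rho (q : rat) : dirichlet :=
  dseries (fun n => if (1 < n)%N then q ^+ n else 0).

Lemma sub_rho_unit (c q : rat) : 1 - dconst c * rho q \is a GRing.unit.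
Proof.
suff -> : (1 - dconst c * rho q \is a GRing.unit) = true by [].
transitivity (1 - dmul (dconst c) (rho q) 1%N != 0); first by [].
by rewrite dmul1coef /= mulr0 subr0 oner_eq0.
Qed.

(* Main.v *)
(** Jung's reduction, in every characteristic: if [(f, g)] is an automorphism
    with [deg f >= deg g] and [deg f > 1], then the leading form of [f] is a
    constant times a power of the leading form of [g].  Let [m', n'] be the
    coprime parts of the two degrees and [theta = f^n' / g^m'], of degree 0.

    If [theta] were transcendental over [k] in the residue field of the
    valuation [- deg], then [deg P(f, g)] would be the weighted degree of [P],
    so [x] and [y], being polynomials in [f] and [g], would both be polynomials
    in [g].  Hence [theta] has a residue in [k]; if [n' = 1], this is the claim.
    If [n' > 1], write [P(f, g)] as a monomial times [F(p, theta)], where [p] is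
    a Laurent monomial in [f] and [g] of degree [- gcd].  The order of [F] at the
    residue of [theta] is at most the weighted degree of [P] over [m' n'], and
    the order of vanishing of [F(p, theta)] is at most that order times the log
    discrepancy of [- deg] (Tougeron-Izumi), which the Jacobian bounds: the
    inequality [deg jac(a, b) <= deg a + deg b - 1], for the derivations in the
    coordinates [x] and [s = y / x], needs no assumption on the characteristic.
    Together they give [deg P(f, g) > 1], which contradicts [x = P(f, g)].

    Subtracting multiples of powers of [g] then counts automorphisms through the
    degree of the smaller component, and yields
    [p_n = sum_(m d = n, d > 1) (q - 1) q^(d - 1) p_m], with [p_1] replaced by
    [(q (q - 1) (q + 1))^2]. *)

Require Import Defs.
From HB Require Import structures.
From mathcomp Require Import all_boot all_order all_algebra.
From mathcomp Require Import finmap mpoly.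
From mathcomp Require Import boolp classical_sets functions cardinality fsbigop.
From mathcomp Require Import all_fingroup polyXY fraction generic_quotient.
From mathcomp Require Import zify ring.

Set Implicit Arguments.
Unset Strict Implicit.
Unset Printing Implicit Defensive.

Import Order.TTheory GRing.Theory Num.Theory.
Local Open Scope classical_set_scope.
Local Open Scope ring_scope.

(** * Nested bivariate polynomials and their evaluation *)

Lemma coef2_bound (R : nzRingType) (F : {poly {poly R}}) : exists N,
  (size F <= N)%N /\ forall i, (size (F`_i)%R <= N)%N.
Proof.
exists (maxn (size F) (\max_(i < size F) size (F`_i)%R)); split; first exact: leq_maxl.
move=> i; have [lti|lei] := ltnP i (size F); last by rewrite nth_default ?size_poly0.
by apply: leq_trans (leq_maxr _ _); rewrite (leq_bigmax (Ordinal lti)).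
Qed.

Section BivariateEvaluation.
Variables (k K : comNzRingType) (io : {rmorphism k -> K}).
Implicit Types (a b : K) (F : {poly {poly k}}).

(** Nesting convention: the outer variable goes to [a] and the inner one to [b], so the entry of
    indices i, j is the coefficient of [a ^+ i * b ^+ j]. *)
Definition eval2 a b : {poly {poly k}} -> K :=
  horner_eval a \o map_poly (horner_eval b \o map_poly io).

HB.instance Definition _ a b := GRing.RMorphism.on (eval2 a b).

Lemma eval2C a b p : eval2 a b p%:P = (map_poly io p).[b].
Proof. by rewrite /eval2 /= map_polyC /= /horner_eval hornerC. Qed.

Lemma eval2X a b : eval2 a b 'X = a.
Proof. by rewrite /eval2 /= map_polyX /horner_eval hornerX. Qed.

Lemma eval2_horner a b F :
  eval2 a b F = (map_poly (horner_eval b \o map_poly io) F).[a].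
Proof. by []. Qed.

Lemma eval2E N a b F : (size F <= N)%N -> (forall i, size (F`_i)%R <= N)%N ->
  eval2 a b F = \sum_(i < N) \sum_(j < N) io F`_i`_j * a ^+ i * b ^+ j.
Proof.
move=> sF sFi; rewrite eval2_horner (@horner_coef_wide _ N); last first.
  exact: leq_trans (size_poly _ _) sF.
apply: eq_bigr => i _; rewrite coef_map /= [horner_eval _ _]horner_evalE.
rewrite (@horner_coef_wide _ N); last exact: leq_trans (size_poly _ _) (sFi _).
by rewrite mulr_suml; apply: eq_bigr => j _; rewrite coef_map mulrAC.
Qed.

Lemma eval2_swap a b F : eval2 b a (swapXY F) = eval2 a b F.
Proof.
have [N [sF sFi]] := coef2_bound F.
have [N' [sF' sFi']] := coef2_bound (swapXY F).
have le1 := leq_maxl N N'; have le2 := leq_maxr N N'.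
rewrite (@eval2E (maxn N N') a b); last 2 first.
- exact: leq_trans le1.
- by move=> i; exact: leq_trans le1.
rewrite (@eval2E (maxn N N')); last 2 first.
- exact: leq_trans le2.
- by move=> i; exact: leq_trans le2.
rewrite exchange_big; apply: eq_bigr => i _; apply: eq_bigr => j _ /=.
by rewrite coef_swapXY mulrAC.
Qed.

(** Isolates the terms free of [a], which dominate when their sum has degree 0 and [a] has negative
    degree. *)
Lemma eval2_split a b F :
  eval2 a b F = (map_poly io F`_0).[b] + a * eval2 a b (drop_poly 1 F).
Proof.
have take1 : take_poly 1 F = (F`_0)%:P.
  by rewrite [LHS]size1_polyC ?size_take_poly // coef_take_poly.
rewrite -[F in LHS](poly_take_drop 1) rmorphD rmorphM rmorphXn /= eval2X expr1.
by rewrite take1 eval2C mulrC.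
Qed.

End BivariateEvaluation.

Lemma rmorph_eval2 (k K L : comNzRingType) (io : {rmorphism k -> K})
    (f : {rmorphism K -> L}) a b F :
  f (eval2 io a b F) = eval2 (f \o io) (f a) (f b) F.
Proof.
have [N [sF sFi]] := coef2_bound F; rewrite !(eval2E _ _ _ sF sFi) rmorph_sum.
apply: eq_bigr => i _; rewrite rmorph_sum; apply: eq_bigr => j _.
by rewrite !rmorphM !rmorphXn.
Qed.

(** * Fields with a degree and two derivations *)

Section LogarithmicDerivative.
Variables (K : fieldType) (D : K -> K).
Hypothesis DM : forall x y, D (x * y) = D x * y + x * D y.

Lemma dlogM x y : x != 0 -> y != 0 -> D (x * y) / (x * y) = D x / x + D y / y.
Proof. by move=> x0 y0; rewrite DM; field; rewrite x0 y0. Qed.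

Lemma dlog1 : D 1 / 1 = 0.
Proof.
have := dlogM (oner_neq0 K) (oner_neq0 K); rewrite mulr1 => /eqP.
by rewrite -{1}[D 1 / 1]addr0 (inj_eq (addrI _)) eq_sym => /eqP.
Qed.

Lemma dlogX x n : x != 0 -> D (x ^+ n) / x ^+ n = n%:R * (D x / x).
Proof.
move=> x0; elim: n => [|n IHn]; first by rewrite dlog1 mul0r.
by rewrite exprS dlogM ?expf_neq0 // IHn -natr1; ring.
Qed.

Lemma dlog_div x y : x != 0 -> y != 0 -> D (x / y) / (x / y) = D x / x - D y / y.
Proof.
move=> x0 y0; apply: (addIr (D y / y)); rewrite subrK -dlogM ?divfK //.
by rewrite mulf_neq0 ?invr_eq0.
Qed.

End LogarithmicDerivative.

(** At the least index j where [q] has a nonzero coefficient, the product has coefficient p_0 q_j.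
    It serves below with [p] a power of X + c. *)
Lemma coef_mul_neq0 (R : idomainType) (p q : {poly R}) : p`_0 != 0 -> q != 0 ->
  exists2 j, (j < size q)%N & (p * q)`_j != 0.
Proof.
move=> p0 q0; have exq : exists j, q`_j != 0.
  by exists (size q).-1; rewrite -lead_coefE lead_coef_eq0.
case: (ex_minnP exq) => j qj minj; exists j.
  by rewrite ltnNge; apply: contra qj => /leq_sizeP/(_ _ (leqnn _)) ->.
rewrite coefM big_ord_recl /= subn0 big1 ?addr0 ?mulf_neq0 // => i _.
have [->|/minj] := eqVneq q`_(j - bump 0 i) 0; first by rewrite mulr0.
by rewrite /bump /=; have := ltn_ord i; lia.
Qed.

Lemma coef2_neq0_bound (R : nzRingType) (F : {poly {poly R}}) N i j :
  (size F <= N)%N -> (forall i, size (F`_i)%R <= N)%N -> F`_i`_j != 0 ->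
  (i < N)%N /\ (j < N)%N.
Proof.
move=> sF sFi Fij; split; rewrite ltnNge; apply: contra Fij => leN.
  by rewrite (nth_default _ (leq_trans sF leN)) coef0.
by rewrite (nth_default _ (leq_trans (sFi _) leN)).
Qed.

Lemma max_weight (R : nzRingType) (F : {poly {poly R}}) m n : F != 0 -> exists W,
  (forall i j, F`_i`_j != 0 -> (m * i + n * j <= W)%N) /\
  (exists i j, F`_i`_j != 0 /\ (m * i + n * j = W)%N).
Proof.
move=> F0; have [N [sF sFi]] := coef2_bound F.
pose Q w := [exists i : 'I_N, exists j : 'I_N,
  (F`_i`_j != 0) && (m * i + n * j == w)%N].
have QP i j : F`_i`_j != 0 -> Q (m * i + n * j)%N.
  move=> Fij; have [lti ltj] := coef2_neq0_bound sF sFi Fij.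
  apply/existsP; exists (Ordinal lti); apply/existsP; exists (Ordinal ltj).
  by rewrite /= Fij eqxx.
have exQ : exists w, Q w.
  have lF : lead_coef (lead_coef F) != 0 by rewrite !lead_coef_eq0.
  by eexists; apply: QP lF.
have leQ w : Q w -> (w <= (m + n) * N)%N.
  case/existsP=> i /existsP[j /andP[_ /eqP <-]].
  by rewrite mulnDl leq_add // leq_mul2l ltnW ?orbT.
case: (ex_maxnP exQ leQ) => W /existsP[i /existsP[j /andP[Fij /eqP eW]]] maxW.
exists W; split; first by move=> i' j' /QP/maxW.
by exists i, j.
Qed.

Section ValuedDifferentialField.
Variables (k K : fieldType) (io : {rmorphism k -> K}) (deg : K -> int).
Implicit Types (x y a b : K) (c : k) (F : {poly {poly k}}).

(** The zero element counts as having degree minus infinity, whatever the value of [deg 0]. *)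
Definition deg_le (x : K) (d : int) := (x == 0) || (deg x <= d).
Hypothesis degM : forall x y, x != 0 -> y != 0 -> deg (x * y) = deg x + deg y.
Hypothesis deg_leD : forall x y d,
  deg_le x d -> deg_le y d -> deg_le (x + y) d.
Hypothesis degC : forall c, deg (io c) = 0.
(** An element of degree 0 has a residue that is either in [k] or transcendental over [k]. *)
Hypothesis residueP : forall x, x != 0 -> deg x = 0 ->
  (exists c, deg_le (x - io c) (-1)) \/
  (forall h : {poly k}, h != 0 ->
     (map_poly io h).[x] != 0 /\ deg (map_poly io h).[x] = 0).

Lemma deg1 : deg 1 = 0. Proof. by rewrite -(rmorph1 io) degC. Qed.

Lemma degN1 : deg (-1) = 0.
Proof. by rewrite -(rmorph1 io) -rmorphN degC. Qed.

Lemma degN x : deg (- x) = deg x.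
Proof.
have [->|x0] := eqVneq x 0; first by rewrite oppr0.
by rewrite -mulN1r degM ?oppr_eq0 ?oner_eq0 // degN1 add0r.
Qed.

Lemma degX x n : x != 0 -> deg (x ^+ n) = deg x * n%:Z.
Proof.
move=> x0; elim: n => [|n IHn]; first by rewrite deg1 mulr0.
by rewrite exprS degM ?expf_neq0 // IHn; lia.
Qed.

Lemma degV x : x != 0 -> deg x^-1 = - deg x.
Proof.
move=> x0; have := degM x0 (_ : x^-1 != 0).
by rewrite invr_eq0 divff // deg1 => /(_ x0); lia.
Qed.

Lemma deg_leW x d d' : d <= d' -> deg_le x d -> deg_le x d'.
Proof. by move=> led /orP[/eqP->|/le_trans le]; rewrite /deg_le ?eqxx // le ?orbT. Qed.

Lemma deg_leN x d : deg_le (- x) d = deg_le x d.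
Proof. by rewrite /deg_le oppr_eq0 degN. Qed.

Lemma deg_leM x y d d' : deg_le x d -> deg_le y d' -> deg_le (x * y) (d + d').
Proof.
have [->|x0] := eqVneq x 0; first by rewrite /deg_le mul0r eqxx.
have [->|y0] := eqVneq y 0; first by rewrite /deg_le mulr0 eqxx.
by rewrite /deg_le mulf_eq0 (negPf x0) (negPf y0) degM //=; apply: lerD.
Qed.

Lemma deg_leM0 x y : deg_le x 0 -> deg_le y 0 -> deg_le (x * y) 0.
Proof. exact: deg_leM. Qed.

Lemma deg_leX0 x n : deg_le x 0 -> deg_le (x ^+ n) 0.
Proof.
move=> x0; elim: n => [|n IHn]; first by rewrite /deg_le deg1 lexx orbT.
by rewrite exprS; apply: deg_leM0.
Qed.

Lemma deg_le_sum (I : Type) (r : seq I) (E : I -> K) d :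
  (forall i, deg_le (E i) d) -> deg_le (\sum_(i <- r) E i) d.
Proof.
move=> leE; elim: r => [|i r IHr]; first by rewrite big_nil /deg_le eqxx.
by rewrite big_cons deg_leD.
Qed.

Lemma deg_leC c : deg_le (io c) 0.
Proof. by rewrite /deg_le degC lexx orbT. Qed.

Lemma degD_lt x y d : x != 0 -> deg_le y d -> d < deg x ->
  x + y != 0 /\ deg (x + y) = deg x.
Proof.
move=> x0 ley ltd; have leyx : deg_le y (deg x) by apply: deg_leW ley; apply: ltW.
have lexx_ : deg_le x (deg x) by rewrite /deg_le lexx orbT.
have xy0 : x + y != 0.
  apply: contraL ltd; rewrite addrC addr_eq0 => /eqP yE.
  by move: ley; rewrite yE deg_leN /deg_le (negPf x0) /= leNgt.
split=> //; apply/le_anti; move: (deg_leD lexx_ leyx).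
rewrite /deg_le (negPf xy0) /= => -> /=.
case: (lerP (deg x) (deg (x + y))) => // ltxy.
(* Otherwise [x + y] and [y] both have degree below [deg x], and so would their difference [x]. *)
have lexy : deg_le (x + y) (Num.max d (deg (x + y))).
  by rewrite /deg_le (negPf xy0) /= le_max lexx orbT.
have := deg_leD lexy (_ : deg_le (- y) _).
rewrite addrK deg_leN => /(_ (deg_leW _ ley)); rewrite le_max lexx => /(_ isT).
by rewrite /deg_le (negPf x0) /= le_max !leNgt ltd ltxy.
Qed.

Lemma deg_le_eval2 a b F : deg_le a 0 -> deg_le b 0 -> deg_le (eval2 io a b F) 0.
Proof.
move=> a0 b0; have [N [sF sFi]] := coef2_bound F; rewrite (eval2E io a b sF sFi).
apply: deg_le_sum => i; apply: deg_le_sum => j.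
by rewrite !deg_leM0 ?deg_leX0 ?deg_leC.
Qed.

(** The part free of [a] has degree 0 because the residue of [b] is transcendental; the rest is a
    multiple of [a], of degree at most -1. *)
Lemma eval2_transc a b F : deg_le a (-1) -> deg_le b 0 -> F`_0 != 0 ->
  (forall h : {poly k}, h != 0 ->
     (map_poly io h).[b] != 0 /\ deg (map_poly io h).[b] = 0) ->
  eval2 io a b F != 0 /\ deg (eval2 io a b F) = 0.
Proof.
move=> a1 b0 F0 /(_ _ F0)[h0 dh]; rewrite eval2_split.
have := @degD_lt _ (a * eval2 io a b (drop_poly 1 F)) (-1) h0.
rewrite dh; apply=> //; rewrite -[-1]addr0 deg_leM // deg_le_eval2 //.
by apply: deg_leW a1.
Qed.

Variables D1 D2 : K -> K.
Hypothesis D1D : {morph D1 : x y / x + y}.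
Hypothesis D2D : {morph D2 : x y / x + y}.
Hypothesis D1M : forall x y, D1 (x * y) = D1 x * y + x * D1 y.
Hypothesis D2M : forall x y, D2 (x * y) = D2 x * y + x * D2 y.
Hypothesis D1C : forall c, D1 (io c) = 0.
Hypothesis D2C : forall c, D2 (io c) = 0.

Definition jac a b := D1 a * D2 b - D2 a * D1 b.

Hypothesis deg_jac : forall a b, a != 0 -> b != 0 ->
  deg_le (jac a b) (deg a + deg b - 1).

Lemma jacC a b : jac b a = - jac a b.
Proof. by rewrite /jac; ring. Qed.

Lemma jaca a : jac a a = 0.
Proof. by rewrite /jac mulrC subrr. Qed.

Lemma jac0 a : jac a 0 = 0.
Proof. by rewrite -(rmorph0 io) /jac D1C D2C !mulr0 subrr rmorph0. Qed.

Lemma jac_addC a b c : jac a (b + io c) = jac a b.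
Proof. by rewrite /jac D1D D2D D1C D2C !addr0. Qed.

Lemma jac_mul a b : jac a (a * b) = a * jac a b.
Proof. by rewrite /jac D1M D2M; ring. Qed.

(** The chain rule. The witnesses are the values of the partial derivatives; they are chosen before
    [D], so that one pair serves both [D1] and [D2]. *)
Lemma deriv_eval2 u v F : exists x y, forall D : K -> K,
  {morph D : a b / a + b} -> (forall a b, D (a * b) = D a * b + a * D b) ->
  (forall c, D (io c) = 0) -> D (eval2 io u v F) = x * D u + y * D v.
Proof.
elim/poly_ind: F => [|F p [x [y IHF]]].
  exists 0, 0 => D _ _ DC; rewrite rmorph0 -(rmorph0 io) DC; ring.
have [y' IHp] : exists y', forall D : K -> K,
    {morph D : a b / a + b} -> (forall a b, D (a * b) = D a * b + a * D b) ->
    (forall c, D (io c) = 0) -> D (eval2 io u v p%:P) = y' * D v.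
  elim/poly_ind: p => [|p c [y' IHp]].
    exists 0 => D _ _ DC; rewrite rmorph0 -(rmorph0 io) DC; ring.
  exists (y' * v + eval2 io u v p%:P) => D DD DM DC.
  rewrite polyCD polyCM rmorphD rmorphM /= !eval2C map_polyX map_polyC hornerX hornerC.
  by rewrite -(eval2C io u) DD DM DC IHp //; ring.
exists (x * u + eval2 io u v F), (y * u + y') => D DD DM DC.
by rewrite rmorphD rmorphM /= eval2X DD DM IHp // IHF //; ring.
Qed.

(** By the chain rule the Jacobian of the two values is [jac u v] times the determinant of the
    partial derivatives. *)
Lemma jac_eval2_neq0 u v P Q :
  jac (eval2 io u v P) (eval2 io u v Q) != 0 -> jac u v != 0.
Proof.
have [x1 [y1 dP]] := deriv_eval2 u v P; have [x2 [y2 dQ]] := deriv_eval2 u v Q.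
rewrite {1}/jac (dP D1) // (dP D2) // (dQ D1) // (dQ D2) //; apply: contraNneq => J0.
by apply/eqP; rewrite -[RHS](mulr0 (x1 * y2 - x2 * y1)) -J0 /jac; ring.
Qed.

(** * Blow-ups and the Tougeron-Izumi inequality *)

Lemma coef2_min_order (F : {poly {poly k}}) i j : F`_i`_j != 0 ->
  exists n, [/\ (n <= i + j)%N, exists2 i0, (i0 <= n)%N & F`_i0`_(n - i0) != 0
     & forall i' j', (i' + j' < n)%N -> F`_i'`_j' = 0].
Proof.
move=> Fij; pose P n := [exists i0 : 'I_n.+1, F`_i0`_(n - i0) != 0].
have PE i' j' : F`_i'`_j' != 0 -> P (i' + j')%N.
  move=> F'; have lti : (i' < (i' + j').+1)%N by rewrite ltnS leq_addr.
  by apply/existsP; exists (Ordinal lti); rewrite /= addKn.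
have exP : exists n, P n by exists (i + j)%N; apply: PE.
case: (ex_minnP exP) => n /existsP[i0 Fi0] minn; exists n; split.
- exact/minn/PE.
- by exists i0 => //; rewrite -ltnS.
move=> i' j'; rewrite ltnNge => /negP nle; apply/eqP; apply: contraT => F'.
by case: nle; apply/minn/PE.
Qed.

(** The strict transform of [F] when [a * (b + c)] replaces [b] and [a ^+ n] is divided out. The
    truncated [i + j - n] is exact on nonzero terms once [n] is at most the order of [F] at the
    origin. *)
Definition blowup n (c : k) N (F : {poly {poly k}}) : {poly {poly k}} :=
  \sum_(i < N) \sum_(j < N)
    (F`_i`_j *: ('X + c%:P) ^+ j)%:P * 'X^(i + j - n).

Lemma eval2_blowup n c N F a b : (size F <= N)%N ->
  (forall i, size (F`_i)%R <= N)%N ->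
  (forall i j, (i + j < n)%N -> F`_i`_j = 0) ->
  eval2 io a (a * (b + io c)) F = a ^+ n * eval2 io a b (blowup n c N F).
Proof.
move=> sF sFi Fn; rewrite (eval2E _ _ _ sF sFi) rmorph_sum mulr_sumr /=.
apply: eq_bigr => i _; rewrite rmorph_sum mulr_sumr; apply: eq_bigr => j _.
rewrite rmorphM rmorphXn /= eval2X eval2C linearZ /= rmorphXn rmorphD /=.
rewrite map_polyX map_polyC /= hornerZ horner_exp hornerD hornerX hornerC.
have [/Fn->|len] := ltnP (i + j) n.
  by rewrite rmorph0; ring.
have aE : a ^+ i * a ^+ j = a ^+ n * a ^+ (i + j - n) by rewrite -!exprD subnKC.
transitivity (io F`_i`_j * (b + io c) ^+ j * (a ^+ i * a ^+ j)).
  by rewrite exprMn; ring.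
by rewrite aE; ring.
Qed.

(** Restriction to the exceptional curve keeps only the form of degree [n] of [F], dehomogenized and
    translated by [c]. *)
Lemma coef0_blowup n c N F : (n < N)%N ->
  (forall i j, (i + j < n)%N -> F`_i`_j = 0) ->
  (blowup n c N F)`_0 = (\poly_(j < n.+1) F`_(n - j)`_j) \Po ('X + c%:P).
Proof.
move=> ltnN Fn; rewrite poly_def raddf_sum /=.
rewrite (big_ord_widen N (fun j => (F`_(n - j)`_j *: 'X^j) \Po ('X + c%:P))) //.
rewrite coef_sum [RHS]big_mkcond /=.
under eq_bigr do rewrite coef_sum.
rewrite [LHS]exchange_big /=; apply: eq_bigr => j _.
rewrite comp_polyZ comp_Xn_poly ltnS.
have termE i : ((F`_i`_j *: ('X + c%:P) ^+ j)%:P * 'X^(i + j - n))`_0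
    = if (i + j == n)%N then F`_i`_j *: ('X + c%:P) ^+ j else 0.
  rewrite coefCM coefXn; have [/Fn->|ltn|->] := ltngtP (i + j) n.
  - by rewrite scale0r mul0r.
  - by rewrite eq_sym subn_eq0 leqNgt ltn mulr0.
  - by rewrite subnn mulr1.
under eq_bigr do rewrite termE.
case: leqP => [lejn|ltnj].
  have ltN : (n - j < N)%N by lia.
  rewrite (bigD1 (Ordinal ltN)) //= subnK // eqxx big1 ?addr0 // => i.
  rewrite -val_eqE /= => /eqP ne; case: eqP => // ijn; case: ne; lia.
by rewrite big1 // => i _; case: eqP => // ijn; exfalso; lia.
Qed.

(** The restriction to the exceptional curve is a nonzero polynomial of degree at most [n], since
    translation preserves the degree. Hence the strict transform has order at most [n] at the new
    centre. *)
Lemma coef0_blowup_neq0 n c N F i0 : (n < N)%N -> (i0 <= n)%N ->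
  (forall i j, (i + j < n)%N -> F`_i`_j = 0) -> F`_i0`_(n - i0) != 0 ->
  exists2 j, (j <= n)%N & (blowup n c N F)`_0`_j != 0.
Proof.
move=> ltnN lei0 Fn F0; rewrite coef0_blowup //.
set q := \poly_(_ < _) _; have q0 : q != 0.
  apply: contraNneq F0 => /polyP/(_ (n - i0)%N).
  by rewrite coef_poly coef0 ltnS leq_subr subKn // => ->.
have sq : size (q \Po ('X + c%:P)) = size q.
  by rewrite size_comp_poly2 // size_XaddC.
exists (size (q \Po ('X + c%:P))).-1.
  have := size_poly n.+1 (fun j => F`_(n - j)`_j); rewrite -/q -sq; lia.
by rewrite -lead_coefE lead_coef_eq0 -size_poly_eq0 sq size_poly_eq0.
Qed.

(** One blow-up costs [|d| * n] for the power of [a] and [l * (A - |d|)] for the strict transform;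
    as [l <= n <= r], the total is at most [r * A]. *)
Lemma izumi_bound (A n r l : nat) (d : int) : d < 0 -> (`|d| <= A)%N ->
  (n <= r)%N -> (l <= n)%N -> - (r * A)%:Z <= d * n%:Z - (l * (A - `|d|))%:Z.
Proof. by case: d => // d _ /=; nia. Qed.

(* A Tougeron-Izumi inequality: the order of vanishing of [F(a, b)] is at most
   the order of [F] at the origin times the log discrepancy of the valuation
   [- deg]; each blow-up of the centre lowers the log discrepancy. *)
Lemma izumi (A : nat) a b F i j : a != 0 -> b != 0 -> deg a < 0 -> deg b < 0 ->
  jac a b != 0 -> - deg (jac a b) - 1 <= A%:Z -> F`_i`_j != 0 ->
  eval2 io a b F != 0 /\ - ((i + j) * A)%:Z <= deg (eval2 io a b F).
Proof.
elim/ltn_ind: A a b F i j => A IHA a b F i j.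
(* Transposing [F] exchanges [a] and [b]; the Jacobian only changes sign. *)
wlog leba : a b F i j / deg b <= deg a => [wlogP|].
  have [leba|/ltW leab] := lerP (deg b) (deg a); first exact: wlogP.
  move=> a0 b0 da db J0 dJ Fij; rewrite -eval2_swap addnC.
  have J'0 : jac b a != 0 by rewrite jacC oppr_eq0.
  have dJ' : - deg (jac b a) - 1 <= A%:Z by rewrite jacC degN.
  have F'ji : (swapXY F)`_j`_i != 0 by rewrite coef_swapXY.
  exact: wlogP leab b0 a0 db da J'0 dJ' F'ji.
move=> a0 b0 da db J0 dJ Fij.
have [n [len [i0 lei0 Fn0] Fn]] := coef2_min_order Fij.
have [N0 [sF sFi]] := coef2_bound F.
have leN0 := leq_maxl N0 n.+1; have ltnN := leq_maxr N0 n.+1.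
have {}sF := leq_trans sF leN0.
have {}sFi i' := leq_trans (sFi i') leN0.
set N := maxn N0 n.+1 in leN0 ltnN sF sFi.
have an0 : a ^+ n != 0 by rewrite expf_neq0.
pose t := b / a; have t0 : t != 0 by rewrite mulf_neq0 ?invr_eq0.
have bE : b = a * t by rewrite mulrC divfK.
have JE : jac a b = a * jac a t by rewrite bE jac_mul.
have Jt0 : jac a t != 0 by apply: contraNneq J0; rewrite JE => ->; rewrite mulr0.
have dJt : deg (jac a b) = deg a + deg (jac a t) by rewrite JE degM.
have dt : deg t = deg b - deg a by rewrite degM ?invr_eq0 // degV.
have dJab : deg (jac a b) <= deg a + deg b - 1.
  by have := deg_jac a0 b0; rewrite /deg_le (negPf J0).
(* The bound on the Jacobian gives [- deg a - deg b <= A], so the bound left after the blow-up is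
   still a natural number. *)
have daA : (`|deg a| <= A)%N by clear - dJ dJab da db; lia.
have [[c small]|transc] : (exists c, deg_le (t - io c) (-1)) \/
  (forall h : {poly k}, h != 0 ->
     (map_poly io h).[t] != 0 /\ deg (map_poly io h).[t] = 0).
- have [dt0|dt0] := eqVneq (deg t) 0; first exact: residueP.
  (* When [t] has negative degree its residue is 0. *)
  left; exists 0; rewrite rmorph0 subr0; apply/orP; right.
  by move: dt0; rewrite dt; clear - leba; lia.
(* The residue [c] gives the next centre. Since [jac a b'] is [jac a b / a], the bound on the log
   discrepancy drops by [- deg a > 0], and the induction applies. *)
- set b' := t - io c in small.
  have Jb' : jac a b' = jac a t by rewrite /b' -rmorphN jac_addC.
  have b'0 : b' != 0.
    by apply: contraNneq Jt0 => b'0; rewrite -Jb' b'0 jac0.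
  have bE' : b = a * (b' + io c) by rewrite subrK.
  have [j' lej' G0] := coef0_blowup_neq0 c ltnN lei0 Fn Fn0.
  rewrite bE' (eval2_blowup c _ _ sF sFi Fn).
  have [] := IHA (A - `|deg a|)%N _ a b' _ _ _ a0 b'0 da _ _ _ G0.
  + by clear - daA da; lia.
  + by move: small; rewrite /deg_le (negPf b'0) /=; clear; lia.
  + by rewrite Jb'.
  + by rewrite Jb'; clear - dJ dJt daA da; lia.
  move=> ev0 dev; rewrite mulf_neq0 //; split=> //; rewrite degM // degX //.
  rewrite add0n in dev; apply: le_trans (lerD (lexx _) dev).
  exact: izumi_bound da daA len lej'.
(* With a transcendental residue the centre is the whole exceptional curve: the strict transform
   takes a value of degree 0, and only the power of [a] counts. *)
have [j' lej' G0] := coef0_blowup_neq0 0 ltnN lei0 Fn Fn0.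
have -> : b = a * (t + io 0) by rewrite rmorph0 addr0.
rewrite (eval2_blowup 0 _ _ sF sFi Fn).
have [] := @eval2_transc a t (blowup n 0 N F).
- by apply/orP; right; clear - da; lia.
- by apply/orP; right; rewrite dt; clear - leba; lia.
- by apply: contraNneq G0 => ->; rewrite coef0.
- exact: transc.
move=> ev0 dev; rewrite mulf_neq0 //; split=> //; rewrite degM // degX // dev addr0.
by have := izumi_bound da daA len (leq0n n); rewrite mul0n oppr0 addr0.
Qed.

(** * Toric coordinates adapted to the degrees of two elements *)

Section ToricChart.
Variables (u v : K) (m n a b e : nat).
Hypotheses (u0 : u != 0) (v0 : v != 0).
Hypotheses (du : deg u = (e * m)%:Z) (dv : deg v = (e * n)%:Z).
Hypotheses (m_gt0 : (0 < m)%N) (n_gt0 : (0 < n)%N).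
Hypothesis bezout : (a * m = b * n + 1)%N.

(** By [bezout] the exponent matrix of [p] and [t] has determinant 1, so [u] and [v] are Laurent
    monomials in them; [p] has degree [- e] and [t] has degree 0. *)
Let p := v ^+ b / u ^+ a.
Let t := u ^+ n / v ^+ m.

Let p0 : p != 0. Proof. by rewrite mulf_neq0 ?invr_eq0 ?expf_neq0. Qed.
Let t0 : t != 0. Proof. by rewrite mulf_neq0 ?invr_eq0 ?expf_neq0. Qed.

Lemma deg_toric_p : deg p = - e%:Z.
Proof.
rewrite degM ?degV ?degX ?invr_eq0 ?expf_neq0 // du dv -!PoszM; apply/eqP.
have -> : (e * m * a = e * n * b + e)%N by clear - bezout; nia.
by rewrite PoszD opprD addrA subrr add0r.
Qed.

Lemma deg_toric_t : deg t = 0.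
Proof.
rewrite degM ?degV ?degX ?invr_eq0 ?expf_neq0 // du dv -!PoszM.
by rewrite mulnAC subrr.
Qed.

Lemma toric_u : u * p ^+ m * t ^+ b = 1.
Proof.
rewrite !expr_div_n -!exprM bezout addn1 exprS (mulnC n) (mulnC b m).
by field; rewrite u0 !expf_neq0.
Qed.

Lemma toric_v : v * p ^+ n * t ^+ a = 1.
Proof.
rewrite !expr_div_n -!exprM (mulnC m) bezout addn1 exprS (mulnC n).
by field; rewrite v0 !expf_neq0.
Qed.

(** On logarithmic derivatives the passage from [u], [v] to [p], [t] is linear, given by the
    exponent matrix of determinant 1. *)
Lemma jac_toric : jac p t * (u * v) = p * t * jac u v.
Proof.
have jacE x y : x != 0 -> y != 0 ->
    jac x y = x * y * (D1 x / x * (D2 y / y) - D2 x / x * (D1 y / y)).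
  by move=> x0 y0; rewrite /jac; field; rewrite x0 y0.
rewrite !jacE // (dlog_div D1M) ?(dlog_div D2M) ?expf_neq0 //.
rewrite (dlog_div D1M) ?(dlog_div D2M) ?expf_neq0 //.
rewrite !(dlogX D1M) ?(dlogX D2M) //.
have bez : a%:R * m%:R = b%:R * n%:R + 1 :> K by rewrite -!natrM bezout natrD.
set x1 := D1 u / u; set x2 := D2 u / u; set y1 := D1 v / v; set y2 := D2 v / v.
transitivity (p * t * (u * v) * ((a%:R * m%:R - b%:R * n%:R) * (x1 * y2 - x2 * y1))).
  by ring.
by rewrite bez; ring.
Qed.

(** The factor [p ^+ W * t ^+ T] clears the negative exponents in the monomials of F(u, v); the
    inner variable stands for [t - c]. *)
Definition toric_transform c N W T F : {poly {poly k}} :=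
  \sum_(i < N) \sum_(j < N)
    (F`_i`_j *: ('X + c%:P) ^+ (T - (b * i + a * j)))%:P
      * 'X^(W - (m * i + n * j)).

Lemma eval2_toric c N W T F : (size F <= N)%N ->
  (forall i, size (F`_i)%R <= N)%N ->
  (forall i j, F`_i`_j != 0 -> (m * i + n * j <= W)%N) ->
  (forall i j, F`_i`_j != 0 -> (b * i + a * j <= T)%N) ->
  eval2 io p (t - io c) (toric_transform c N W T F)
    = eval2 io u v F * p ^+ W * t ^+ T.
Proof.
move=> sF sFi leW leT; rewrite (eval2E _ u v sF sFi) rmorph_sum !mulr_suml /=.
apply: eq_bigr => i _; rewrite rmorph_sum !mulr_suml; apply: eq_bigr => j _.
rewrite rmorphM rmorphXn /= eval2X eval2C linearZ /= rmorphXn rmorphD /=.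
rewrite map_polyX map_polyC /= hornerZ horner_exp hornerD hornerX hornerC subrK.
have [->|Fij] := eqVneq F`_i`_j 0; first by rewrite rmorph0; ring.
have pW : p ^+ W = p ^+ (W - (m * i + n * j)) * ((p ^+ m) ^+ i * (p ^+ n) ^+ j).
  by rewrite -!exprM -!exprD subnK ?leW.
have tT : t ^+ T = t ^+ (T - (b * i + a * j)) * ((t ^+ b) ^+ i * (t ^+ a) ^+ j).
  by rewrite -!exprM -!exprD subnK ?leT.
rewrite pW tT.
transitivity (io F`_i`_j * t ^+ (T - (b * i + a * j)) * p ^+ (W - (m * i + n * j))
   * ((u * p ^+ m * t ^+ b) ^+ i * (v * p ^+ n * t ^+ a) ^+ j)).
  by rewrite toric_u toric_v !expr1n !mulr1.
by rewrite !exprMn; ring.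
Qed.

(** The part of [F] of weight [W] as a polynomial in [t], that is, the transform at [p = 0] before
    the translation by [c]. *)
Definition toric_edge N W S F : {poly k} :=
  \sum_(i < N) \sum_(j < N)
    (if (m * i + n * j == W)%N then F`_i`_j *: 'X^(S - (b * i + a * j)) else 0).

Lemma coef0_toric c N W T F :
  (forall i j, F`_i`_j != 0 -> (m * i + n * j <= W)%N) ->
  (toric_transform c N W T F)`_0 = toric_edge N W T F \Po ('X + c%:P).
Proof.
move=> leW; rewrite coef_sum [RHS]raddf_sum; apply: eq_bigr => i _ /=.
rewrite coef_sum raddf_sum; apply: eq_bigr => j _ /=.
rewrite coefCM coefXn [in RHS](fun_if (comp_poly _)) comp_poly0 comp_polyZ comp_Xn_poly.
have [->|Fij] := eqVneq F`_i`_j 0; first by rewrite !scale0r mul0r if_same.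
have := leW _ _ Fij; rewrite leq_eqVlt => /orP[/eqP ->|ltW].
  by rewrite subnn !eqxx mulr1.
by rewrite (ltn_eqF ltW) eq_sym subn_eq0 leqNgt ltW mulr0.
Qed.

(* On the edge [m * i + n * j = W] the points are [(i0 + n * s, j0 - m * s)],
   along which [b * i + a * j] decreases by [s]. *)
Lemma edge_param i j i0 j0 : (i0 <= i)%N ->
  (m * i + n * j = m * i0 + n * j0)%N ->
  exists s, [/\ i = (i0 + n * s)%N, j0 = (j + m * s)%N
    & (b * i0 + a * j0 = b * i + a * j + s)%N].
Proof.
move=> le0; have copr : coprime n m.
  rewrite /coprime -dvdn1 -(dvdn_addr _ (dvdn_mull b (dvdn_gcdl n m))).
  by rewrite -bezout dvdn_mull ?dvdn_gcdr.
have lem : (m * i0 <= m * i)%N by rewrite leq_mul2l le0 orbT.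
move=> eq0; have {eq0}eqW : (m * (i - i0) + n * j = n * j0)%N.
  by rewrite mulnBr; clear - lem eq0; lia.
have le0j : (j <= j0)%N.
  by rewrite -(leq_pmul2l n_gt0) -eqW leq_addl.
have /dvdnP[s sE] : (n %| i - i0)%N.
  rewrite -(Gauss_dvdr _ copr) -(dvdn_addl _ (dvdn_mulr j (dvdnn n))) eqW.
  exact: dvdn_mulr.
have jE : j0 = (j + m * s)%N.
  by apply/eqP; rewrite -(eqn_pmul2l n_gt0) -eqW sE; apply/eqP; ring.
have iE : i = (i0 + n * s)%N by rewrite mulnC -sE subnKC.
exists s; split=> //; rewrite iE jE.
have -> : (a * (j + m * s) = a * j + a * m * s)%N by ring.
by rewrite bezout; ring.
Qed.

(** Up to a power of [t], which does not vanish at [c], the edge polynomial has degree at most the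
    number of lattice steps along the edge. Each step changes [i] by [n], hence uses [m * n] of the
    weight [W]; the order of vanishing at [c] is at most that degree. *)
Lemma toric_edge_neq0 c N W T F i1 j1 : c != 0 ->
  (size F <= N)%N -> (forall i, size (F`_i)%R <= N)%N ->
  (forall i j, F`_i`_j != 0 -> (b * i + a * j <= T)%N) ->
  F`_i1`_j1 != 0 -> (m * i1 + n * j1 = W)%N ->
  exists2 l, (l * (m * n) <= W)%N & (toric_edge N W T F \Po ('X + c%:P))`_l != 0.
Proof.
move=> c0 sF sFi leT F1 e1.
pose Q i := [exists j : 'I_N, (F`_i`_j != 0) && (m * i + n * j == W)%N].
have QP i j : F`_i`_j != 0 -> (m * i + n * j = W)%N -> Q i.
  move=> Fij eW; have [_ ltj] := coef2_neq0_bound sF sFi Fij.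
  by apply/existsP; exists (Ordinal ltj); rewrite /= Fij eW eqxx.
have exQ : exists i, Q i by exists i1; apply: QP F1 e1.
case: (ex_minnP exQ) => i0 /existsP[j0 /andP[F0 /eqP e0]] mini0.
(* The end of the edge with least [i] has the largest [b * i + a * j], so it alone gives the
   constant term of [H]. *)
pose S := (b * i0 + a * j0)%N; pose H := toric_edge N W S F.
have edgeE i j : F`_i`_j != 0 -> (m * i + n * j = W)%N ->
    exists2 s, (s * (m * n) <= W)%N & S = (b * i + a * j + s)%N.
  move=> Fij eW; have := @edge_param i j i0 j0 (mini0 _ (QP _ _ Fij eW)).
  by case; [rewrite eW e0|move=> s [iE jE SE]; exists s => //; clear - eW iE; nia].
have leST : (S <= T)%N by exact: leT F0.
have HE : toric_edge N W T F = 'X^(T - S) * H.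
  rewrite mulr_sumr; apply: eq_bigr => i _; rewrite mulr_sumr; apply: eq_bigr => j _.
  case: eqP => [eW|_]; last by rewrite mulr0.
  have [->|Fij] := eqVneq F`_i`_j 0; first by rewrite !scale0r mulr0.
  have [s _ SE] := edgeE _ _ Fij eW.
  rewrite -scalerAr -exprD; congr (_ *: 'X^_).
  by move: leST (leT _ _ Fij); rewrite SE; clear; lia.
have H0 : H`_0 = F`_i0`_j0.
  have [lti0 ltj0] := coef2_neq0_bound sF sFi F0.
  rewrite coef_sum (bigD1 (Ordinal lti0)) //= coef_sum (bigD1 j0) //= e0 eqxx.
  rewrite coefZ coefXn subnn mulr1 big1 ?addr0 => [|j /negP jj0]; last first.
    case: eqP => [eW|_]; last by rewrite coef0.
    by case: jj0; rewrite -val_eqE /= -(eqn_pmul2l n_gt0) -(eqn_add2l (m * i0)) eW e0.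
  rewrite big1 ?addr0 // => i /negP ii0; rewrite coef_sum big1 // => j _.
  case: eqP => [eW|_]; last by rewrite coef0.
  have [->|Fij] := eqVneq F`_i`_j 0; first by rewrite scale0r coef0.
  have [s _ SE] := edgeE _ _ Fij eW.
  have [s0|s_gt0] := posnP s; last first.
    by rewrite SE addKn coefZ coefXn eq_sym gtn_eqF ?mulr0.
  case: ii0; rewrite -val_eqE /=; apply/eqP.
  have [s' [iE _ SE']] := edge_param (mini0 _ (QP _ _ Fij eW)) (etrans eW (esym e0)).
  by move: SE SE' iE; rewrite /S s0; clear; nia.
have sH l : H`_l != 0 -> (l * (m * n) <= W)%N.
  apply: contraR => ltW; rewrite coef_sum big1 // => i _.
  rewrite coef_sum big1 // => j _; case: eqP => [eW|_]; last by rewrite coef0.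
  have [->|Fij] := eqVneq F`_i`_j 0; first by rewrite scale0r coef0.
  have [s les SE] := edgeE _ _ Fij eW; rewrite SE addKn coefZ coefXn.
  by case: eqP => [ls|]; [move: ltW; rewrite ls les|rewrite mulr0].
have Hneq0 : H != 0 by apply: contraNneq F0 => HH; rewrite -H0 HH coef0.
have sHc : size (H \Po ('X + c%:P)) = size H by rewrite size_comp_poly2 ?size_XaddC.
have [] := @coef_mul_neq0 _ (('X + c%:P) ^+ (T - S)) (H \Po ('X + c%:P)).
- by rewrite -horner_coef0 horner_exp hornerD hornerX hornerC add0r expf_neq0.
- by rewrite -size_poly_eq0 sHc size_poly_eq0.
move=> l ltl Hl; exists l; last by rewrite HE rmorphM /= comp_Xn_poly.
apply: leq_trans (sH (size H).-1 _); last by rewrite -lead_coefE lead_coef_eq0.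
by rewrite leq_mul2r; apply/orP; right; move: ltl; rewrite sHc; clear; lia.
Qed.

End ToricChart.

(** * Jung's reduction in a valued differential field *)

Lemma jac_affine a b c d : jac a (io c * b + io d) = io c * jac a b.
Proof. by rewrite jac_addC /jac D1M D2M D1C D2C; ring. Qed.

(** A transcendental residue prevents cancellation on the edge, so [deg x] is [e] times the weighted
    degree [W] of [F]; since it is 1, both are 1. *)
Lemma eval2_toric_transc (u v : K) (m n a b e : nat) F x : u != 0 -> v != 0 ->
  deg u = (e * m)%:Z -> deg v = (e * n)%:Z -> (0 < m)%N -> (0 < n)%N ->
  (a * m = b * n + 1)%N ->
  (forall h : {poly k}, h != 0 -> (map_poly io h).[u ^+ n / v ^+ m] != 0 /\
     deg (map_poly io h).[u ^+ n / v ^+ m] = 0) ->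
  (0 < e)%N -> eval2 io u v F = x -> x != 0 -> deg x = 1 ->
  e = 1%N /\ (forall i j, F`_i`_j != 0 -> (m * i + n * j <= 1)%N).
Proof.
move=> u0 v0 du dv m0 n0 bez transc e0 evF x0 dx.
have F0 : F != 0 by apply: contraNneq x0 => F0; rewrite -evF F0 rmorph0.
have [W [leW [i1 [j1 [F1 eW]]]]] := max_weight m n F0.
have [T [leT _]] := max_weight b a F0.
have [N [sF sFi]] := coef2_bound F.
set t := u ^+ n / v ^+ m in transc; set p := v ^+ b / u ^+ a.
have t0 : t != 0 by rewrite mulf_neq0 ?invr_eq0 ?expf_neq0.
have p0 : p != 0 by rewrite mulf_neq0 ?invr_eq0 ?expf_neq0.
have dp : deg p = - e%:Z by exact: deg_toric_p u0 v0 du dv bez.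
have dt : deg t = 0 by exact: deg_toric_t u0 v0 du dv.
have deg_monomial : deg (x * p ^+ W * t ^+ T) = 1 - (e * W)%:Z.
  have pW0 : p ^+ W != 0 by rewrite expf_neq0.
  have tT0 : t ^+ T != 0 by rewrite expf_neq0.
  rewrite degM ?(mulf_neq0 x0 pW0) // degM // !degX // dx dp dt mul0r addr0.
  by rewrite mulNr PoszM.
have ev := eval2_toric u0 v0 bez 0 sF sFi leW leT.
rewrite rmorph0 subr0 evF -/p -/t in ev.
(* Any nonzero constant will do: the translate only shows that the edge polynomial is nonzero. *)
have [l _] := toric_edge_neq0 n0 bez (oner_neq0 k) sF sFi leT F1 eW.
have [->|edge0 _] := eqVneq (toric_edge m n a b N W T F) 0.
  by rewrite comp_poly0 coef0 eqxx.
have [] := @eval2_transc p t (toric_transform m n a b 0 N W T F) _ _ _ transc.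
- by apply/orP; right; rewrite dp; clear - e0; lia.
- by apply/orP; right; rewrite dt.
- by rewrite coef0_toric // addr0 comp_polyXr.
rewrite ev => _; rewrite deg_monomial.
move=> eW1; have {}eW1 : (e * W = 1)%N by clear - eW1; lia.
have /andP[/eqP e1 /eqP W1] : (e == 1)%N && (W == 1)%N by rewrite -muln_eq1 eW1.
by rewrite e1; rewrite W1 in leW.
Qed.

(** The order [l] at the residue satisfies [l * (m * n) <= W], while the Tougeron-Izumi inequality
    gives [e * W <= 1 + l * (e * (m + n + 1) - 2)]. As [m + n + 1 <= m * n], only [l = 0] remains,
    and then [F] is constant. *)
Lemma eval2_toric_algebraic (u v : K) (m n a b e : nat) F x c : u != 0 -> v != 0 ->
  deg u = (e * m)%:Z -> deg v = (e * n)%:Z -> (1 < n)%N -> (n < m)%N ->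
  (a * m = b * n + 1)%N ->
  jac u v != 0 -> 1 <= deg (jac u v) -> c != 0 ->
  deg_le (u ^+ n / v ^+ m - io c) (-1) ->
  (0 < e)%N -> eval2 io u v F = x -> x != 0 -> deg x = 1 -> False.
Proof.
move=> u0 v0 du dv n1 ltnm bez J0 dJ c0 small e0 evF x0 dx.
have F0 : F != 0 by apply: contraNneq x0 => F0; rewrite -evF F0 rmorph0.
have [W [leW [i1 [j1 [F1 eW]]]]] := max_weight m n F0.
have [T [leT _]] := max_weight b a F0.
have [N [sF sFi]] := coef2_bound F.
have n0 := ltnW n1; have m0 := ltn_trans n0 ltnm.
set t := u ^+ n / v ^+ m in small; set p := v ^+ b / u ^+ a.
have t0 : t != 0 by rewrite mulf_neq0 ?invr_eq0 ?expf_neq0.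
have p0 : p != 0 by rewrite mulf_neq0 ?invr_eq0 ?expf_neq0.
have dp : deg p = - e%:Z by exact: deg_toric_p u0 v0 du dv bez.
have dt : deg t = 0 by exact: deg_toric_t u0 v0 du dv.
have deg_monomial : deg (x * p ^+ W * t ^+ T) = 1 - (e * W)%:Z.
  have pW0 : p ^+ W != 0 by rewrite expf_neq0.
  have tT0 : t ^+ T != 0 by rewrite expf_neq0.
  rewrite degM ?(mulf_neq0 x0 pW0) // degM // !degX // dx dp dt mul0r addr0.
  by rewrite mulNr PoszM.
have ev := eval2_toric u0 v0 bez c sF sFi leW leT.
rewrite evF -/p -/t in ev.
have [l lel Fl] := toric_edge_neq0 n0 bez c0 sF sFi leT F1 eW.
rewrite -coef0_toric // in Fl.
have JE := jac_toric u0 v0 bez; rewrite -/p -/t in JE.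
have Jpt0 : jac p t != 0.
  apply: contraNneq J0 => Jpt0; move/esym/eqP: JE.
  by rewrite Jpt0 mul0r mulf_eq0 (negPf (mulf_neq0 p0 t0)).
have dJpt : deg (jac p t) + (deg u + deg v) = deg p + deg t + deg (jac u v).
  by rewrite -(degM u0 v0) -(degM Jpt0 (mulf_neq0 u0 v0)) JE
    (degM (mulf_neq0 p0 t0) J0) (degM p0 t0).
have Jpt' : jac p (t - io c) = jac p t by rewrite -rmorphN jac_addC.
have t'0 : t - io c != 0.
  by apply: contraNneq Jpt0 => t'0; rewrite -Jpt' t'0 jac0.
(* The constant bounds [- deg (jac p t) - 1]: by [jac_toric], [deg (jac p t)] is at least
   [1 - e - e * (m + n)]. *)
have [] := @izumi (e * (m + n + 1) - 2) p (t - io c) _ 0 l p0 t'0 _ _ _ _ Fl.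
- by rewrite dp; clear - e0; lia.
- by move: small; rewrite /deg_le (negPf t'0) /=; clear; lia.
- by rewrite Jpt'.
- rewrite Jpt'; move: dJpt; rewrite du dv dp dt; clear - dJ e0 n0; nia.
rewrite ev => _; rewrite deg_monomial.
rewrite add0n => le1.
have {}le1 : (e * W <= 1 + l * (e * (m + n + 1) - 2))%N by clear - le1; lia.
have [l0|l_gt0] := posnP l.
  (* Now [W <= 1 < n < m], so [F] is constant and its value has degree 0 instead of 1. *)
  have W1 : (W <= 1)%N by move: le1; rewrite l0; clear - e0; nia.
  have Fij0 i j : F`_i`_j != 0 -> i = 0%N /\ j = 0%N.
    by move=> /leW; clear - W1 n1 ltnm; nia.
  move: evF; rewrite (@size1_polyC _ F); last first.
    apply/leq_sizeP => i i_gt0; apply/polyP => j; rewrite coef0; apply/eqP.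
    by apply: contraTT i_gt0 => /Fij0[-> _].
  rewrite eval2C (@size1_polyC _ F`_0) ?map_polyC ?hornerC.
    by move=> xE; move: dx; rewrite -xE degC.
  apply/leq_sizeP => j j_gt0; apply/eqP.
  by apply: contraTT j_gt0 => /Fij0[_ ->].
have mn : (m + n + 1 <= m * n)%N by clear - n1 ltnm; nia.
have : (l * (e * (m + n + 1)) <= e * W)%N.
  rewrite mulnCA leq_mul2l; apply/orP; right; apply: leq_trans lel.
  by rewrite leq_mul2l mn orbT.
move: le1; rewrite mulnBr; clear - l_gt0 e0 n0; have : (2 <= e * (m + n + 1))%N by nia.
by move=> /(leq_mul (leqnn l)); lia.
Qed.

Lemma leading_form_power (u v x y : K) (m n : nat) P Q : u != 0 -> v != 0 ->
  deg u = m%:Z -> deg v = n%:Z -> (0 < n)%N -> (n <= m)%N -> (1 < m)%N ->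
  1 <= deg (jac u v) ->
  x != 0 -> y != 0 -> deg x = 1 -> deg y = 1 -> jac x y != 0 ->
  eval2 io u v P = x -> eval2 io u v Q = y ->
  exists d c, [/\ m = (d * n)%N, c != 0
    & deg_le (u - io c * v ^+ d) (m%:Z - 1)].
Proof.
move=> u0 v0 du dv n_gt0 lenm m_gt1 dJ x0 y0 dx dy Jxy evP evQ.
have J0 : jac u v != 0 by apply: (@jac_eval2_neq0 _ _ P Q); rewrite evP evQ.
have e_gt0 : (0 < gcdn m n)%N by rewrite gcdn_gt0 n_gt0 orbT.
have [/dvdnP[m' mE] /dvdnP[n' nE]] := (dvdn_gcdl m n, dvdn_gcdr m n).
have copr : coprime m' n'.
  by rewrite /coprime -(eqn_pmul2r e_gt0) muln_gcdl -mE -nE mul1n.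
move: mE nE e_gt0; set e := gcdn m n; clearbody e; rewrite ![(_ * e)%N]mulnC.
move=> mE nE e_gt0; subst m n.
have n'_gt0 : (0 < n')%N by move: n_gt0; rewrite muln_gt0 => /andP[].
have lenm' : (n' <= m')%N by rewrite -(leq_pmul2l e_gt0).
have m'_gt0 : (0 < m')%N := leq_trans n'_gt0 lenm'.
have [a b bez _] : egcdn_spec m' n' (egcdn m' n') by exact: egcdnP.
rewrite (eqP copr) in bez.
set t := u ^+ n' / v ^+ m'.
have t0 : t != 0 by rewrite mulf_neq0 ?invr_eq0 ?expf_neq0.
have dt : deg t = 0 by exact: deg_toric_t u0 v0 du dv.
have [[c small]|transc] := residueP t0 dt.
  have c0 : c != 0.
    by apply: contraTneq small => ->; rewrite rmorph0 subr0 /deg_le (negPf t0) dt.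
  have [n1|n_neq1] := eqVneq n' 1%N.
    exists m', c; split=> //; first by rewrite n1 muln1 mulnC.
    have -> : u - io c * v ^+ m' = (t - io c) * v ^+ m'.
      by rewrite mulrBl /t n1 divfK ?expf_neq0.
    apply: deg_leW (deg_leM small (_ : deg_le _ (deg v * m'%:Z))).
      by rewrite dv n1; clear; lia.
    by rewrite -degX // /deg_le lexx orbT.
  have n1 : (1 < n')%N by rewrite ltn_neqAle eq_sym n_neq1.
  have ltnm : (n' < m')%N.
    rewrite ltn_neqAle lenm' andbT; apply: contraNneq n_neq1 => nm.
    by move: copr; rewrite -nm /coprime gcdnn.
  by case: (eval2_toric_algebraic u0 v0 du dv n1 ltnm bez J0 dJ c0 small e_gt0 evP).
have [e1 suppP] :=
  eval2_toric_transc u0 v0 du dv m'_gt0 n'_gt0 bez transc e_gt0 evP x0 dx.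
have [_ suppQ] :=
  eval2_toric_transc u0 v0 du dv m'_gt0 n'_gt0 bez transc e_gt0 evQ y0 dy.
rewrite e1 mul1n in m_gt1.
(* As [m' > 1], a polynomial of weighted degree at most 1 is affine in [v] alone; with both [x] and
   [y] of this form, their Jacobian would vanish. *)
have affine F : (forall i j, F`_i`_j != 0 -> (m' * i + n' * j <= 1)%N) ->
    eval2 io u v F = io F`_0`_1 * v + io F`_0`_0.
  move=> supp; rewrite (@size1_polyC _ F); last first.
    apply/leq_sizeP => i i_gt0; apply/polyP => j; rewrite coef0; apply/eqP.
    by apply: contraTT i_gt0 => /supp; clear - m_gt1; nia.
  rewrite eval2C (@horner_coef_wide _ 2).
    by rewrite !big_ord_recl big_ord0 !coef_map coefC /= mulr1 addr0 addrC.
  rewrite size_map_poly; apply/leq_sizeP => j j_gt1; apply/eqP.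
  by apply: contraTT j_gt1 => /supp; clear - n'_gt0; nia.
move: Jxy; rewrite -evP -evQ !affine // jac_affine jacC jac_affine jaca.
by rewrite mulr0 oppr0 mulr0 eqxx.
Qed.

End ValuedDifferentialField.

(** * Degree and derivations on a field of fractions *)

Section Fractions.
Variable R : idomainType.
Local Notation "p %:F" := (@FracField.tofrac R p).
Implicit Types (x y : {fraction R}) (p q r s : R).

Lemma frac_numden x : x = (\n_(repr x))%:F / (\d_(repr x))%:F.
Proof.
have d0 := denom_ratioP (repr x).
apply: (canRL (mulfK _)); first by rewrite tofrac_eq0.
rewrite -{1}[x]reprK; set r := repr x in d0 *; clearbody r.
unlock FracField.tofrac; rewrite -[LHS]FracField.pi_mul; apply/eqmodP.
rewrite /= FracField.equivfE /FracField.mulf.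
by rewrite !numden_Ratio ?oner_eq0 ?mulf_neq0 ?oner_eq0 ?mulr1 // mulrC.
Qed.

Lemma frac_ratioP x : exists p q, q != 0 /\ x = p%:F / q%:F.
Proof.
exists \n_(repr x), \d_(repr x); split; first exact: denom_ratioP.
exact: frac_numden.
Qed.

Lemma frac_eq p q r s : q != 0 -> s != 0 ->
  (p%:F / q%:F == r%:F / s%:F) = (p * s == r * q).
Proof. by move=> q0 s0; rewrite eqr_div ?tofrac_eq0 // -!tofracM tofrac_eq. Qed.

Lemma frac_neq0 p q : q != 0 -> (p%:F / q%:F != 0) = (p != 0).
Proof. by move=> q0; rewrite mulf_eq0 invr_eq0 !tofrac_eq0 (negPf q0) orbF. Qed.

Section Derivation.
Variable D : R -> R.
Hypothesis DD : {morph D : p q / p + q}.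
Hypothesis DM : forall p q, D (p * q) = D p * q + p * D q.

Definition frac_deriv x : {fraction R} :=
  let n := \n_(repr x) in let d := \d_(repr x) in
  (D n * d - n * D d)%:F / (d ^+ 2)%:F.

(** Independence of the representative: differentiating the cross-multiplied equality of the two
    fractions relates their quotient rules. *)
Lemma frac_derivE p q : q != 0 ->
  frac_deriv (p%:F / q%:F) = (D p * q - p * D q)%:F / (q ^+ 2)%:F.
Proof.
move=> q0; set x := _ / _; rewrite /frac_deriv.
have := frac_numden x; have := denom_ratioP (repr x).
move: (\n_(repr x)) (\d_(repr x)) => n d d0 /eqP.
rewrite frac_eq // => /eqP pd; apply/eqP; rewrite frac_eq ?expf_neq0 //.
have := congr1 D pd; rewrite !DM => Dpd; apply/eqP.
transitivity ((D n * q + n * D q) * (d * q) - n * q * (D d * q + d * D q)); first by ring.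
rewrite -Dpd -pd; ring.
Qed.

Lemma derivation1 : D 1 = 0.
Proof.
have := DM 1 1; rewrite !mulr1 mul1r -{1}[D 1]addr0 => /addrI/esym; exact.
Qed.

Lemma frac_derivF p : frac_deriv p%:F = (D p)%:F.
Proof.
rewrite -[p%:F]divr1 -[1 in LHS](rmorph1 (@FracField.tofrac R)).
by rewrite frac_derivE ?oner_eq0 // derivation1 mulr0 subr0 mulr1 expr1n rmorph1 divr1.
Qed.

Lemma frac_derivD : {morph frac_deriv : x y / x + y}.
Proof.
move=> x y; have [p [q [q0 ->]]] := frac_ratioP x; have [r [s [s0 ->]]] := frac_ratioP y.
have [q0F s0F] : q%:F != 0 /\ s%:F != 0 by rewrite !tofrac_eq0.
rewrite addf_div // -!tofracM -tofracD !frac_derivE ?mulf_neq0 //.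
rewrite DD !DM addf_div ?tofrac_eq0 ?expf_neq0 // -!tofracM -tofracD.
by apply/eqP; rewrite frac_eq ?mulf_neq0 ?expf_neq0 ?mulf_neq0 //; apply/eqP; ring.
Qed.

Lemma frac_derivM x y :
  frac_deriv (x * y) = frac_deriv x * y + x * frac_deriv y.
Proof.
have [p [q [q0 ->]]] := frac_ratioP x; have [r [s [s0 ->]]] := frac_ratioP y.
have [q0F s0F] : q%:F != 0 /\ s%:F != 0 by rewrite !tofrac_eq0.
rewrite mulf_div -!tofracM !frac_derivE ?mulf_neq0 // !mulf_div -!tofracM.
rewrite addf_div ?tofrac_eq0 ?mulf_neq0 ?expf_neq0 // -!tofracM -tofracD !DM.
by apply/eqP; rewrite frac_eq ?mulf_neq0 ?expf_neq0 ?mulf_neq0 //; apply/eqP; ring.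
Qed.

End Derivation.
End Fractions.

(** * The degree on the field of fractions *)

Section FractionDegree.
Variables (R : idomainType) (dg : R -> nat).
Local Notation "p %:F" := (@FracField.tofrac R p).
Implicit Types (x y : {fraction R}) (p q r s : R).
Hypothesis dgM : forall p q, p != 0 -> q != 0 -> dg (p * q) = (dg p + dg q)%N.
Hypothesis dgD : forall p q, (dg (p + q) <= maxn (dg p) (dg q))%N.

Definition frac_deg x : int :=
  if x == 0 then 0 else (dg \n_(repr x))%:Z - (dg \d_(repr x))%:Z.

Lemma dg1 : dg 1 = 0%N.
Proof.
by apply/eqP; rewrite -(eqn_add2l (dg 1)) -dgM ?oner_eq0 // mulr1 addn0.
Qed.

Lemma dgN p : dg (- p) = dg p.
Proof.
have [->|p0] := eqVneq p 0; first by rewrite oppr0.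
have N1 : -1 != 0 :> R by rewrite oppr_eq0 oner_eq0.
have /eqP := dgM N1 N1; rewrite mulrNN mulr1 dg1 eq_sym addn_eq0 => /andP[/eqP dgN1 _].
by rewrite -mulN1r dgM // dgN1.
Qed.

Lemma frac_degE p q : p != 0 -> q != 0 ->
  frac_deg (p%:F / q%:F) = (dg p)%:Z - (dg q)%:Z.
Proof.
move=> p0 q0; set x := _ / _; rewrite /frac_deg.
have x0 : x != 0 by rewrite frac_neq0.
rewrite (negPf x0); have := frac_numden x; have := denom_ratioP (repr x).
move: (\n_(repr x)) (\d_(repr x)) => n d d0 xE.
have n0 : n != 0 by move: x0; rewrite xE frac_neq0.
by move/eqP: xE; rewrite frac_eq // => /eqP/(congr1 dg); rewrite !dgM //; lia.
Qed.

Lemma frac_degF p : p != 0 -> frac_deg p%:F = (dg p)%:Z.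
Proof.
move=> p0; rewrite -[p%:F]divr1 -[1 in LHS](tofrac1 R).
by rewrite frac_degE ?oner_eq0 // dg1 subr0.
Qed.

Lemma frac_degM x y : x != 0 -> y != 0 ->
  frac_deg (x * y) = frac_deg x + frac_deg y.
Proof.
have [p [q [q0 ->]]] := frac_ratioP x; have [r [s [s0 ->]]] := frac_ratioP y.
rewrite !frac_neq0 // => p0 r0; rewrite mulf_div -!tofracM.
by rewrite !frac_degE ?mulf_neq0 // !dgM //; lia.
Qed.

Lemma frac_deg_leE p q d : q != 0 ->
  deg_le frac_deg (p%:F / q%:F) d = (p == 0) || ((dg p)%:Z <= (dg q)%:Z + d).
Proof.
move=> q0; rewrite /deg_le -[_ == 0]negbK frac_neq0 // negbK.
have [//|p0] := eqVneq p 0.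
by rewrite frac_degE // lerBlDl.
Qed.

Lemma frac_deg_leD x y d : deg_le frac_deg x d -> deg_le frac_deg y d ->
  deg_le frac_deg (x + y) d.
Proof.
have [p [q [q0 ->]]] := frac_ratioP x; have [r [s [s0 ->]]] := frac_ratioP y.
have [->|p0] := eqVneq p 0; first by rewrite rmorph0 mul0r add0r.
have [->|r0] := eqVneq r 0; first by rewrite rmorph0 mul0r addr0.
rewrite addf_div ?tofrac_eq0 // -!tofracM -tofracD !frac_deg_leE ?mulf_neq0 //.
rewrite (negPf p0) (negPf r0) /= => dp dr; apply/orP; right.
apply: (@le_trans _ _ ((maxn (dg (p * s)) (dg (r * q)))%:Z)).
  by rewrite lez_nat dgD.
by rewrite !dgM //; lia.
Qed.

Section DegreeOfDerivative.
Variables (D : R -> R) (e : nat).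
Hypothesis DM : forall p q, D (p * q) = D p * q + p * D q.
Hypothesis dg_deriv : forall p, D p != 0 -> (dg (D p) + e <= dg p)%N.

Lemma frac_deg_deriv x : x != 0 ->
  deg_le frac_deg (frac_deriv D x) (frac_deg x - e%:Z).
Proof.
have [p [q [q0 ->]]] := frac_ratioP x; rewrite frac_neq0 // => p0.
rewrite (frac_derivE DM) // tofracB mulrBl frac_degE //.
have dgq2 : dg (q ^+ 2) = (dg q + dg q)%N by rewrite expr2 dgM.
apply: frac_deg_leD; last first.
  rewrite -mulNr -tofracN frac_deg_leE ?expf_neq0 // dgq2 oppr_eq0 dgN.
  have [->|Dq0] := eqVneq (D q) 0; first by rewrite mulr0 eqxx.
  by rewrite dgM //; have := dg_deriv Dq0; lia.
rewrite frac_deg_leE ?expf_neq0 // dgq2.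
have [->|Dp0] := eqVneq (D p) 0; first by rewrite mul0r eqxx.
by rewrite dgM //; have := dg_deriv Dp0; lia.
Qed.

End DegreeOfDerivative.
End FractionDegree.

(** * Jung's reduction transported from the field of fractions to the domain *)

Section ValuedDifferentialDomain.
Variables (k : fieldType) (R : idomainType) (io : {rmorphism k -> R}).
Variables (dg : R -> nat) (D1 D2 : R -> R).
Local Notation "p %:F" := (@FracField.tofrac R p).
Hypothesis dgM : forall p q, p != 0 -> q != 0 -> dg (p * q) = (dg p + dg q)%N.
Hypothesis dgD : forall p q, (dg (p + q) <= maxn (dg p) (dg q))%N.
Hypothesis dgC : forall c, dg (io c) = 0%N.

(** The numerator of h(p / q) over the denominator [q ^+ (size h).-1]. *)
Definition homogenize (h : {poly k}) (p q : R) : R :=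
  \sum_(i < size h) io h`_i * p ^+ i * q ^+ ((size h).-1 - i).

Hypothesis residueP : forall p q, p != 0 -> q != 0 -> dg p = dg q ->
  (exists c, p = io c * q \/ (dg (p - io c * q) < dg q)%N) \/
  (forall h, h != 0 ->
     homogenize h p q != 0 /\ dg (homogenize h p q) = ((size h).-1 * dg q)%N).

Hypothesis D1D : {morph D1 : p q / p + q}.
Hypothesis D2D : {morph D2 : p q / p + q}.
Hypothesis D1M : forall p q, D1 (p * q) = D1 p * q + p * D1 q.
Hypothesis D2M : forall p q, D2 (p * q) = D2 p * q + p * D2 q.
Hypothesis D1C : forall c, D1 (io c) = 0.
Hypothesis D2C : forall c, D2 (io c) = 0.
Hypothesis dgD1 : forall p, D1 p != 0 -> (dg (D1 p) + 1 <= dg p)%N.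
Hypothesis dgD2 : forall p, D2 p != 0 -> (dg (D2 p) + 0 <= dg p)%N.

Let ioF : {rmorphism k -> {fraction R}} := @FracField.tofrac R \o io.
Let deg := frac_deg dg.

Let degC c : deg (ioF c) = 0.
Proof.
have [->|c0] := eqVneq c 0; first by rewrite rmorph0 /deg /frac_deg eqxx.
by rewrite /deg /ioF /= frac_degF ?fmorph_eq0 // dgC.
Qed.

Lemma horner_homogenize h p q : q != 0 ->
  (map_poly ioF h).[p%:F / q%:F] = (homogenize h p q)%:F / (q ^+ (size h).-1)%:F.
Proof.
move=> q0; have qF0 : q%:F != 0 by rewrite tofrac_eq0.
rewrite horner_coef size_map_poly rmorph_sum mulr_suml; apply: eq_bigr => i _.
rewrite coef_map /ioF /= expr_div_n !tofracM !tofracXn.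
have le_i : (i <= (size h).-1)%N by have := ltn_ord i; clear; lia.
rewrite -[in RHS](subnKC le_i) addKn exprD.
have qi0 : q%:F ^+ i != 0 by rewrite expf_neq0.
have qd0 : q%:F ^+ ((size h).-1 - i) != 0 by rewrite expf_neq0.
move: (q%:F ^+ i) (q%:F ^+ (_ - _)) (p%:F ^+ i) (io h`_i)%:F qi0 qd0 => a b c d a0 b0.
by rewrite invfM -!mulrA (mulrCA b) mulfV // mulr1.
Qed.

Let residueF x : x != 0 -> deg x = 0 ->
  (exists c, deg_le deg (x - ioF c) (-1)) \/
  (forall h : {poly k}, h != 0 ->
     (map_poly ioF h).[x] != 0 /\ deg (map_poly ioF h).[x] = 0).
Proof.
have [p [q [q0 ->]]] := frac_ratioP x; rewrite frac_neq0 // => p0.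
rewrite /deg frac_degE // => /eqP; rewrite subr_eq0 eqz_nat => /eqP dpq.
have [[c cE]|transc] := residueP p0 q0 dpq; [left; exists c|right => h h0].
  have qF0 : q%:F != 0 by rewrite tofrac_eq0.
  have -> : p%:F / q%:F - ioF c = (p - io c * q)%:F / q%:F.
    by rewrite tofracB tofracM mulrBl mulfK.
  rewrite frac_deg_leE //; case: cE => [->|ltc]; first by rewrite subrr eqxx.
  by apply/orP; right; rewrite -ltzD1 subrK ltz_nat.
have [hom0 dgh] := transc h h0; rewrite horner_homogenize // frac_neq0 ?expf_neq0 //.
split=> //; rewrite frac_degE ?expf_neq0 // dgh.
suff -> n : dg (q ^+ n) = (n * dg q)%N by rewrite subrr.
elim: n => [|n IHn]; first by rewrite (dg1 dgM).
by rewrite exprS dgM ?expf_neq0 // IHn mulSn.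
Qed.

(** Each product in the Jacobian has one factor differentiated by [D1], which lowers the degree by
    1, and one by [D2], which does not raise it. *)
Let deg_jac (x y : {fraction R}) : x != 0 -> y != 0 ->
  deg_le deg (jac (frac_deriv D1) (frac_deriv D2) x y) (deg x + deg y - 1).
Proof.
move=> x0 y0; have fracM := frac_degM dgM; have fracD := frac_deg_leD dgM dgD.
have d1 z z0 := @frac_deg_deriv _ _ dgM dgD _ _ D1M dgD1 z z0.
have d2 z z0 := @frac_deg_deriv _ _ dgM dgD _ _ D2M dgD2 z z0.
apply: fracD.
  apply: deg_leW (deg_leM fracM (d1 x x0) (d2 y y0)).
  by rewrite /deg; lia.
rewrite (deg_leN fracM degC).
apply: deg_leW (deg_leM fracM (d2 x x0) (d1 y y0)).
by rewrite /deg; lia.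
Qed.

Lemma leading_form_power_domain (U V X Y : R) P Q : U != 0 -> V != 0 ->
  (0 < dg V)%N -> (dg V <= dg U)%N -> (1 < dg U)%N ->
  (D1 U * D2 V - D2 U * D1 V != 0 -> (0 < dg (D1 U * D2 V - D2 U * D1 V))%N) ->
  X != 0 -> Y != 0 -> dg X = 1%N -> dg Y = 1%N ->
  D1 X * D2 Y - D2 X * D1 Y != 0 ->
  eval2 io U V P = X -> eval2 io U V Q = Y ->
  exists d c, [/\ dg U = (d * dg V)%N, c != 0
    & U = io c * V ^+ d \/ (dg (U - io c * V ^+ d) < dg U)%N].
Proof.
move=> U0 V0 dV leUV dU dJ X0 Y0 dX dY JXY evP evQ.
have jacF p q : jac (frac_deriv D1) (frac_deriv D2) p%:F q%:F
    = (D1 p * D2 q - D2 p * D1 q)%:F.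
  by rewrite /jac !(frac_derivF D1M) !(frac_derivF D2M) tofracB !tofracM.
have evF F : eval2 ioF U%:F V%:F F = (eval2 io U V F)%:F by rewrite rmorph_eval2.
have D1CF c : frac_deriv D1 (ioF c) = 0 by rewrite (frac_derivF D1M) D1C tofrac0.
have D2CF c : frac_deriv D2 (ioF c) = 0 by rewrite (frac_derivF D2M) D2C tofrac0.
have D1DF := frac_derivD D1D D1M; have D2DF := frac_derivD D2D D2M.
have D1MF := frac_derivM D1M; have D2MF := frac_derivM D2M.
have JUV : D1 U * D2 V - D2 U * D1 V != 0.
  rewrite -tofrac_eq0 -jacF.
  apply: (@jac_eval2_neq0 _ _ ioF _ _ D1DF D2DF D1MF D2MF D1CF D2CF _ _ P Q).
  by rewrite !evF evP evQ jacF tofrac_eq0.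
have := @leading_form_power k _ ioF deg (frac_degM dgM) (frac_deg_leD dgM dgD) degC
  residueF _ _ D1DF D2DF D1MF D2MF D1CF D2CF deg_jac
  U%:F V%:F X%:F Y%:F (dg U) (dg V) P Q.
rewrite !tofrac_eq0 /deg !frac_degF // dX dY !jacF !evF evP evQ tofrac_eq0.
rewrite frac_degF // => lfp.
have [d [c [dUV c0 small]]] : exists d c, [/\ dg U = (d * dg V)%N, c != 0
   & deg_le (frac_deg dg) (U%:F - ioF c * V%:F ^+ d) ((dg U)%:Z - 1)].
  by apply: lfp => //; rewrite lez_nat dJ.
exists d, c; split=> //.
move: small; rewrite /ioF /= -tofracXn -tofracM -tofracB /deg_le tofrac_eq0.
have [/eqP|nz] := eqVneq (U - io c * V ^+ d) 0; first by rewrite subr_eq0 => /eqP; left.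
by rewrite frac_degF //= => le; right; move: le; clear; lia.
Qed.

End ValuedDifferentialDomain.

(** * Leading forms in the plane *)

Section PolynomialDegree.
Variable k : fieldType.
Local Notation R := {poly {poly k}}.
Implicit Types (p q : R) (h : {poly k}).

(** This is the algebraic closedness of [k] in the field of rational functions. Once the gcd is
    removed, the cofactor of [B] divides a power of the coprime cofactor of [A], so it is constant;
    the cofactor of [A] is then algebraic over [k], hence constant too. *)
Lemma homogeneous_relation (A B h : {poly k}) : A != 0 -> B != 0 -> h != 0 ->
  \sum_(i < size h) h`_i *: (A ^+ i * B ^+ ((size h).-1 - i)) = 0 ->
  exists c, A = c *: B.
Proof.
move=> A0 B0 h0; set G := gcdp A B; pose A' := A %/ G; pose B' := B %/ G.
have AE : A = A' * G by rewrite divpK ?dvdp_gcdl.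
have BE : B = B' * G by rewrite divpK ?dvdp_gcdr.
have copr : coprimep A' B' by apply: coprimep_div_gcd; rewrite A0.
have G0 : G != 0 by rewrite gcdp_eq0 (negPf A0).
move=> rel.
have {}rel : \sum_(i < size h) h`_i *: (A' ^+ i * B' ^+ ((size h).-1 - i)) = 0.
  apply: (mulIf (expf_neq0 (size h).-1 G0)); rewrite mul0r -[RHS]rel mulr_suml.
  apply: eq_bigr => i _; rewrite AE BE !exprMn -scalerAl; congr (_ *: _).
  have le_i : (i <= (size h).-1)%N by have := ltn_ord i; clear; lia.
  by rewrite -[in X in _ * G ^+ X](subnKC le_i) exprD mulrACA.
have hE : size h = (size h).-1.+1 by rewrite prednK ?size_poly_gt0.
have B'1 : size B' == 1%N.
  have /coprimepP cop : coprimep B' (A' ^+ (size h).-1).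
    by rewrite coprimep_sym coprimep_expl.
  rewrite size_poly_eq1; apply: (cop B' (dvdpp _)).
  move: rel; rewrite hE big_ord_recr /= subnn expr0 mulr1 -lead_coefE => /eqP.
  rewrite addrC addr_eq0 => /eqP rel.
  rewrite -(@dvdpZr _ (lead_coef h)) ?lead_coef_eq0 // rel dvdpNr.
  apply: (big_ind (fun r => B' %| r)) => [|x y|i _]; [exact: dvdp0|exact: dvdp_add|].
  by rewrite -mul_polyC !dvdp_mull // -(subnSK (ltn_ord i)) exprS dvdp_mulr.
have /size_poly1P[b b0 B'E] := B'1.
have A'1 : (size A' <= 1)%N.
  rewrite leqNgt; apply/negP => A'1.
  pose h' := \poly_(i < size h) (h`_i * b ^+ ((size h).-1 - i)).
  have : h' \Po A' == 0.
    rewrite -rel /h' poly_def raddf_sum /=; apply/eqP; apply: eq_bigr => i _.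
    by rewrite comp_polyZ comp_Xn_poly B'E -!rmorphXn -!mul_polyC polyCM; ring.
  rewrite comp_poly_eq0 // => /eqP/polyP/(_ (size h).-1).
  rewrite coef_poly -hE leqnn subnn mulr1 coef0 => /eqP.
  by rewrite -lead_coefE lead_coef_eq0 (negPf h0).
exists (A'`_0 / b); rewrite [LHS]AE BE B'E -mul_polyC mulrA -polyCM divfK //.
by rewrite -size1_polyC.
Qed.

(** The degree in the outer variable only, which is the total degree after the substitution y = s
    x. *)
Definition pdeg (p : R) : nat := (size p).-1.

Definition coef_deriv (p : R) : R := map_poly (@deriv k) p.

Lemma pdegM p q : p != 0 -> q != 0 -> pdeg (p * q) = (pdeg p + pdeg q)%N.
Proof.
move=> p0 q0; rewrite /pdeg size_mul // (polySpred p0) (polySpred q0).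
by rewrite addSn addnS.
Qed.

Lemma pdegD p q : (pdeg (p + q) <= maxn (pdeg p) (pdeg q))%N.
Proof.
have le_pq : (size (p + q)%R <= maxn (size p) (size q))%N := size_polyD p q.
by rewrite /pdeg; lia.
Qed.

Lemma coef_derivM (p q : R) :
  coef_deriv (p * q) = coef_deriv p * q + p * coef_deriv q.
Proof.
apply/polyP => n; rewrite coefD coef_map !coefM raddf_sum -big_split /=.
by apply: eq_bigr => i _; rewrite !coef_map derivM.
Qed.

Lemma pdegX p i : p != 0 -> pdeg (p ^+ i) = (pdeg p * i)%N.
Proof. by move=> p0; rewrite /pdeg size_exp. Qed.

Let io : {rmorphism k -> R} := polyC \o polyC.

(** The coefficient in degree [(size h).-1 * pdeg q] is [h] homogenized at the leading coefficients;
    it is nonzero, so the top terms do not cancel. *)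
Lemma pdeg_homogenize p q h : p != 0 -> q != 0 -> pdeg p = pdeg q ->
  \sum_(i < size h)
     h`_i *: (lead_coef p ^+ i * lead_coef q ^+ ((size h).-1 - i)) != 0 ->
  homogenize io h p q != 0 /\ pdeg (homogenize io h p q) = ((size h).-1 * pdeg q)%N.
Proof.
move=> p0 q0 dpq lc0; set d := (size h).-1; set H := homogenize _ _ _ _.
have pq0 (i : 'I_(size h)) : p ^+ i * q ^+ (d - i) != 0.
  by rewrite mulf_neq0 ?expf_neq0.
have dpqi (i : 'I_(size h)) : pdeg (p ^+ i * q ^+ (d - i)) = (d * pdeg q)%N.
  rewrite pdegM ?expf_neq0 // !pdegX // dpq -mulnDr subnKC 1?mulnC //.
  by have := ltn_ord i; rewrite /d; clear; lia.
have HE : H = \sum_(i < size h) (h`_i)%:P *: (p ^+ i * q ^+ (d - i)).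
  by apply: eq_bigr => i _; rewrite -mulrA mul_polyC.
have coefH : H`_(d * pdeg q) != 0.
  rewrite HE coef_sum; apply: contraNneq lc0 => E; apply/eqP; rewrite -[RHS]E.
  apply: eq_bigr => i _; rewrite coefZ mul_polyC; congr (_ *: _).
  by rewrite -(dpqi i) -lead_coefE lead_coefM !lead_coef_exp.
split; first by apply: contraNneq coefH => ->; rewrite coef0.
have sz : (d * pdeg q < size H)%N.
  by rewrite ltnNge; apply: contra coefH => /leq_sizeP/(_ _ (leqnn _)) ->.
apply/eqP; rewrite eqn_leq [pdeg H]/((size H).-1) -andbC -ltnS (ltn_predK sz) sz.
suff : (size H <= (d * pdeg q).+1)%N by rewrite -{1}(ltn_predK sz).
rewrite HE; apply: (big_ind (fun r : R => size r <= (d * pdeg q).+1)%N) => [|x y sx sy|i _].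
- by rewrite size_poly0.
- by apply: leq_trans (size_polyD _ _) _; rewrite geq_max sx.
apply: leq_trans (size_scale_leq _ _) _.
by have := dpqi i; rewrite /pdeg; clear; lia.
Qed.

(** The residue of p / q is the ratio of the leading coefficients. If it lies in [k], subtraction
    lowers the degree; otherwise [homogeneous_relation] makes it transcendental. *)
Lemma pdeg_residue p q : p != 0 -> q != 0 -> pdeg p = pdeg q ->
  (exists c, p = io c * q \/ (pdeg (p - io c * q) < pdeg q)%N) \/
  (forall h, h != 0 -> homogenize io h p q != 0 /\
     pdeg (homogenize io h p q) = ((size h).-1 * pdeg q)%N).
Proof.
move=> p0 q0 dpq; have lp0 : lead_coef p != 0 by rewrite lead_coef_eq0.
have lq0 : lead_coef q != 0 by rewrite lead_coef_eq0.
(* The only candidate for a constant ratio, read off from the leading coefficients in the inner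
   variable. *)
pose c := lead_coef (lead_coef p) / lead_coef (lead_coef q).
have [lE|lN] := eqVneq (lead_coef p) (c *: lead_coef q).
  left; exists c; have [->|pq0] := eqVneq p (io c * q); [by left|right].
  have pos : (0 < size (p - io c * q)%R)%N by rewrite size_poly_gt0 subr_eq0.
  have p_gt0 : (0 < size p)%N by rewrite size_poly_gt0.
  have q_gt0 : (0 < size q)%N by rewrite size_poly_gt0.
  rewrite /pdeg in dpq *; suff : (size (p - io c * q)%R < size q)%N.
    by move: pos; clear; lia.
  rewrite -(prednK q_gt0) ltnS; apply/leq_sizeP => j lej.
  rewrite coefB /io /= coefCM.
  have [<-|jneq] := eqVneq (size q).-1 j.
    by rewrite -lead_coefE -dpq -lead_coefE lE mul_polyC subrr.
  have ltj : (size q <= j)%N by move: lej jneq; clear; lia.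
  have lepj : (size p <= j)%N by move: ltj dpq p_gt0 q_gt0; clear; lia.
  by rewrite (nth_default _ lepj) (nth_default _ ltj) mulr0 subr0.
right=> h h0; apply: pdeg_homogenize => //; apply/eqP => rel.
have [c' cE] := homogeneous_relation lp0 lq0 h0 rel.
case/eqP: lN; rewrite {1}cE; congr (_ *: _); rewrite /c cE lead_coefZ mulfK //.
by rewrite lead_coef_eq0.
Qed.

Lemma leading_form_power_poly (U V : R) P Q :
  (0 < pdeg V)%N -> (pdeg V <= pdeg U)%N -> (1 < pdeg U)%N ->
  (size (U`_0)%R <= 1)%N -> (size (V`_0)%R <= 1)%N ->
  eval2 io U V P = 'X -> eval2 io U V Q = 'X%:P * 'X ->
  exists d c, [/\ pdeg U = (d * pdeg V)%N, c != 0
    & (pdeg (U - io c * V ^+ d) < pdeg U)%N].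
Proof.
move=> dV leUV dU U00 V00 evP evQ.
have nz p : (0 < pdeg p)%N -> p != 0.
  by apply: contraTneq => ->; rewrite /pdeg size_poly0.
have [U0 V0] := (nz _ (ltnW dU), nz _ dV).
have DXC c : deriv (io c) = 0 by rewrite derivC.
have DCC c : coef_deriv (io c) = 0 by rewrite /coef_deriv map_polyC /= derivC.
have size_deriv p : deriv p != 0 -> (pdeg (deriv p) + 1 <= pdeg p)%N.
  have [->|p0] := eqVneq p 0; first by rewrite deriv0 eqxx.
  by rewrite -size_poly_gt0 /pdeg; have := lt_size_deriv p0; lia.
have size_coef_deriv p : coef_deriv p != 0 -> (pdeg (coef_deriv p) + 0 <= pdeg p)%N.
  have le_p : (size (coef_deriv p) <= size p)%N by exact: size_poly.
  by rewrite addn0 /pdeg; move: le_p; clear; lia.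
have coef0D p : (size (p`_0)%R <= 1)%N -> (coef_deriv p)`_0 = 0.
  by move=> /size1_polyC p00; rewrite coef_map p00 /= derivC.
have dgC c : pdeg (io c) = 0%N.
  by rewrite /pdeg size_polyC; case: eqP.
have coef_derivX : coef_deriv 'X = 0.
  apply/polyP => i; rewrite coef_map coefX coef0 /=.
  by case: eqP => _; rewrite ?derivC // -[1]/(1%:P) derivC.
have coef_derivCX : coef_deriv ('X%:P * 'X) = 'X.
  rewrite coef_derivM coef_derivX mulr0 addr0 /coef_deriv map_polyC /= derivX.
  by rewrite mul1r.
have coef_derivD : {morph coef_deriv : p q / p + q}.
  by move=> p q; apply/polyP => i; rewrite coefD !coef_map /= coefD derivD.
have JXY : ('X)^`() * coef_deriv ('X%:P * 'X) - coef_deriv 'X * ('X%:P * 'X)^`() != 0 :> R.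
  by rewrite coef_derivCX coef_derivX mul0r subr0 derivX mul1r polyX_eq0.
have X0 : 'X != 0 :> R by rewrite polyX_eq0.
have Y0 : 'X%:P * 'X != 0 :> R by rewrite mulf_neq0 ?polyC_eq0 ?polyX_eq0.
have dX : pdeg 'X = 1%N by rewrite /pdeg size_polyX.
have dY : pdeg ('X%:P * 'X) = 1%N.
  by rewrite pdegM ?polyC_eq0 ?polyX_eq0 // dX /pdeg size_polyC polyX_eq0.
have dJ : U^`() * coef_deriv V - coef_deriv U * V^`() != 0 ->
    (0 < pdeg (U^`() * coef_deriv V - coef_deriv U * V^`()))%N.
  (* At X = 0 both components are constants, so the Jacobian vanishes there; in degree 0 it would
     equal its constant coefficient, which is 0. *)
  set J := _ - _; have J00 : J`_0 = 0.
    by rewrite coefB !coef0M !coef0D // mulr0 mul0r subrr.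
  rewrite lt0n; apply: contraNneq => /eqP; rewrite /pdeg -leqn0 -subn1 leq_subLR addn0.
  by move=> /size1_polyC ->; rewrite J00 polyC0.
have [d [c [dUV c0 small]]] := @leading_form_power_domain k R io pdeg deriv
  coef_deriv pdegM pdegD dgC pdeg_residue (@derivD _) coef_derivD (@derivM _)
  coef_derivM DXC DCC size_deriv size_coef_deriv U V 'X ('X%:P * 'X) P Q U0 V0
  dV leUV dU dJ X0 Y0 dX dY JXY evP evQ.
exists d, c; split=> //; case: small => // UE.
by rewrite -UE subrr {1}/pdeg size_poly0; apply: ltnW.
Qed.

End PolynomialDegree.

Section MultivariateEvaluation.
Variables (n : nat) (R S T : comNzRingType).

Lemma rmorph_mmap (f : {rmorphism R -> S}) (g : {rmorphism S -> T}) h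
    (p : {mpoly R[n]}) :
  g (mmap f h p) = mmap (g \o f) (g \o h) p.
Proof.
rewrite rmorph_sum; apply: eq_bigr => m _; rewrite rmorphM; congr (_ * _).
by rewrite rmorph_prod; apply: eq_bigr => i _; rewrite rmorphXn.
Qed.

Lemma eq_mmap (f f' : R -> S) h h' (p : {mpoly R[n]}) :
  f =1 f' -> h =1 h' -> mmap f h p = mmap f' h' p.
Proof.
move=> eqf eqh; apply: eq_bigr => m _; rewrite eqf; congr (_ * _).
by apply: eq_bigr => i _; rewrite eqh.
Qed.

End MultivariateEvaluation.

(** * The plane in the coordinates x and s = y / x *)

Section TwoVariables.
Variable k : finFieldType.
Local Notation A2 := {mpoly k[2]}.
Local Notation R := {poly {poly k}}.
Implicit Types (p q f g : A2) (c : k).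

Let io : {rmorphism k -> R} := polyC \o polyC.

Lemma mnm2_eq (m m' : 'X_{1..2}) :
  mdeg m = mdeg m' -> m ord_max = m' ord_max -> m = m'.
Proof.
rewrite !mdegE !big_ord_recr !big_ord0 /= !add0n => eq_deg eq1.
have eq0 : m (widen_ord (leqnSn 1) ord_max) = m' (widen_ord (leqnSn 1) ord_max).
  by apply/eqP; rewrite -(eqn_add2r (m ord_max)) {2}eq1; apply/eqP.
apply/mnmP => i; case: i => [[|[|i]] lti] //.
  by rewrite (_ : Ordinal _ = widen_ord (leqnSn 1) ord_max) //; apply: val_inj.
by rewrite (_ : Ordinal _ = ord_max) //; apply: val_inj.
Qed.

(* In the coordinates [x = 'X] and [y = s 'X] the total degree becomes the
   degree in ['X], and the coefficients are polynomials in [s]. *)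
Definition radial : A2 -> R :=
  mmap io (fun i => if i == ord0 then 'X else 'X%:P * 'X).

HB.instance Definition _ := GRing.RMorphism.on radial.

Lemma radialB p q : radial (p - q) = radial p - radial q.
Proof. exact: rmorphB. Qed.

Lemma radialZ c p : radial (c *: p) = c%:P%:P * radial p.
Proof. exact: mmapZ. Qed.

Lemma radialX p n : radial (p ^+ n) = radial p ^+ n.
Proof. exact: rmorphXn. Qed.

Lemma radialE p :
  radial p = \sum_(m <- msupp p) (p@_m *: 'X^(m ord_max))%:P * 'X^(mdeg m).
Proof.
apply: eq_bigr => m _; rewrite /mmap1 mdegE !big_ord_recr !big_ord0 /= mul1r add0n.
rewrite exprMn -rmorphXn exprD -mul_polyC polyCM; ring.
Qed.

(** The monomial x^i y^j goes to s^j X^(i + j), from which i and j are recovered, so no two terms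
    merge. *)
Lemma coef_radial p (m : 'X_{1..2}) : (radial p)`_(mdeg m)`_(m ord_max) = p@_m.
Proof.
rewrite radialE !coef_sum.
have termE m' : ((p@_m' *: 'X^(m' ord_max))%:P * 'X^(mdeg m'))`_(mdeg m)`_(m ord_max)
    = if m' == m then p@_m else 0.
  rewrite coefCM coefXn; have [->|ne] := eqVneq m' m.
    by rewrite eqxx mulr1 coefZ coefXn eqxx mulr1.
  have [degE|_] := eqVneq (mdeg m) (mdeg m'); last by rewrite mulr0 coef0.
  rewrite mulr1 coefZ coefXn.
  have [e1|_] := eqVneq (m ord_max) (m' ord_max); last by rewrite mulr0.
  by rewrite (mnm2_eq degE e1) eqxx in ne.
under eq_bigr do rewrite termE.
have [pm0|pm] := boolP (m \in msupp p).
  by rewrite (bigD1_seq m) ?msupp_uniq //= eqxx big1 ?addr0 // => m' /negPf ->.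
move: (pm); rewrite -mcoeff_eq0 => /eqP ->.
by rewrite big1 // => m' _; rewrite if_same.
Qed.

Lemma coef_radial_large p d : (msize p <= d)%N -> (radial p)`_d = 0.
Proof.
move=> led; rewrite radialE coef_sum big_seq big1 // => m /msize_mdeg_lt ltm.
by rewrite coefCM coefXn gtn_eqF ?mulr0 // (leq_trans ltm).
Qed.

Lemma size_radial p : size (radial p) = msize p.
Proof.
apply/eqP; rewrite eqn_leq; apply/andP; split.
  by apply/leq_sizeP => d; apply: coef_radial_large.
have [->|p0] := eqVneq p 0; first by rewrite msize0.
rewrite -(mlead_deg p0) ltnNge; apply/negP => /leq_sizeP/(_ _ (leqnn _)) c0.
by have := coef_radial p (mlead p); rewrite c0 coef0 => /esym/eqP;
  rewrite mleadc_eq0 (negPf p0).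
Qed.

Lemma pdeg_radial p : pdeg (radial p) = tdeg p.
Proof. by rewrite /pdeg size_radial. Qed.

Lemma size_coef0_radial p : (size ((radial p)`_0)%R <= 1)%N.
Proof.
rewrite radialE coef_sum; apply: (big_ind (fun r : {poly k} => size r <= 1)%N).
- by rewrite size_poly0.
- by move=> q r sq sr; apply: leq_trans (size_polyD _ _) _; rewrite geq_max sq.
move=> m _; rewrite coefCM coefXn eq_sym mdeg_eq0.
have [->|_] := eqVneq m 0%MM; last by rewrite mulr0 size_poly0.
rewrite mnm0E expr0 mulr1; apply: leq_trans (size_scale_leq _ _) _.
by rewrite size_poly1.
Qed.

Definition bipoly : A2 -> R := mmap io (fun i => if i == ord0 then 'X else 'X%:P).

Lemma alg_hom_mmap (phi : A2 -> A2) p : linear phi -> monoid_morphism phi ->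
  phi p = mmap (@mpolyC 2 k) (fun i => phi 'X_i) p.
Proof.
move=> phiL [phi1 phiM].
have phiD u v : phi (u + v) = phi u + phi v by have := phiL 1 u v; rewrite !scale1r.
have phi0 : phi 0 = 0 by apply: (addrI (phi 0)); rewrite -phiD !addr0.
have phiZ c u : phi (c *: u) = c *: phi u by have := phiL c u 0; rewrite !addr0 phi0 addr0.
have phiX u i : phi (u ^+ i) = phi u ^+ i.
  by elim: i => [|i IHi]; rewrite ?phi1 // !exprS phiM IHi.
rewrite [in LHS](mpolyE p) (big_morph phi phiD phi0); apply: eq_bigr => m _.
rewrite phiZ mul_mpolyC mpolyXE_id (big_morph phi phiM phi1); congr (_ *: _).
by apply: eq_bigr => i _; rewrite phiX.
Qed.

Lemma radial_alg_hom (phi : A2 -> A2) p : linear phi -> monoid_morphism phi ->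
  radial (phi p) =
  eval2 io (radial (phi 'X_ord0)) (radial (phi 'X_ord_max)) (bipoly p).
Proof.
move=> phiL phiM; rewrite (alg_hom_mmap p phiL phiM) !rmorph_mmap.
apply: eq_mmap => [c|i] /=.
  by rewrite /radial mmapC eval2C /= map_polyC hornerC.
case: i => [[|[|i]] lti] //=.
  by rewrite eval2X; congr (radial (phi 'X__)); apply: val_inj.
by rewrite eval2C map_polyX hornerX; congr (radial (phi 'X__)); apply: val_inj.
Qed.

End TwoVariables.

(** * Automorphisms of the plane *)

Section AutomorphismPairs.
Variable k : finFieldType.
Local Notation A2 := {mpoly k[2]}.
Local Notation x := ('X_ord0 : A2).
Local Notation y := ('X_ord_max : A2).
Implicit Types (p q f g u v : A2) (c : k) (phi psi : A2 -> A2).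

Lemma tdeg0 : tdeg (0 : A2) = 0%N. Proof. by rewrite /tdeg msize0. Qed.

Lemma tdegM p q : p != 0 -> q != 0 -> tdeg (p * q) = (tdeg p + tdeg q)%N.
Proof.
move=> p0 q0; have mp : (0 < msize p)%N by rewrite lt0n msize_poly_eq0.
have mq : (0 < msize q)%N by rewrite lt0n msize_poly_eq0.
by rewrite /tdeg msizeM // -(prednK mp) -(prednK mq) addSn addnS.
Qed.

Lemma tdegX p n : p != 0 -> tdeg (p ^+ n) = (n * tdeg p)%N.
Proof.
move=> p0; elim: n => [|n IHn]; first by rewrite /tdeg msize1.
by rewrite exprS tdegM ?expf_neq0 // IHn mulSn.
Qed.

Lemma tdegZ c p : c != 0 -> tdeg (c *: p) = tdeg p.
Proof. by move=> c0; rewrite /tdeg msizeZ. Qed.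

Lemma tdegN p : tdeg (- p) = tdeg p.
Proof. by rewrite -scaleN1r tdegZ // oppr_eq0 oner_eq0. Qed.

Lemma tdegD_le p q d : (tdeg p <= d)%N -> (tdeg q <= d)%N -> (tdeg (p + q) <= d)%N.
Proof.
have : (msize (p + q) <= maxn (msize p) (msize q))%N by exact: msizeD_le.
by rewrite /tdeg; lia.
Qed.

Lemma tdeg_eq0 p : tdeg p = 0%N -> p = (p@_0)%:MP.
Proof.
rewrite /tdeg => p0; apply: msize1_polyC; move: p0.
by case: (msize p) => [|[]].
Qed.

Definition alg_hom phi := linear phi /\ monoid_morphism phi.

Lemma alg_hom_ext phi psi : alg_hom phi -> alg_hom psi ->
  phi x = psi x -> phi y = psi y -> phi =1 psi.
Proof.
move=> [phiL phiM] [psiL psiM] ex ey p.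
rewrite (alg_hom_mmap p phiL phiM) (alg_hom_mmap p psiL psiM).
by apply: eq_mmap => // -[[|[|i]] lti] //.
Qed.

Lemma alg_hom_id : alg_hom id.
Proof. by split=> // c u v; rewrite linearP. Qed.

Lemma alg_hom_comp phi psi : alg_hom phi -> alg_hom psi -> alg_hom (phi \o psi).
Proof.
move=> [phiL [phi1 phiM]] [psiL [psi1 psiM]]; split.
  by move=> c u v /=; rewrite psiL phiL.
by split=> [|u v] /=; rewrite ?psi1 ?phi1 // psiM phiM.
Qed.

Definition subst2 f g p : A2 := p \mPo [tuple f; g].

Lemma subst2_hom f g : alg_hom (subst2 f g).
Proof.
split=> [c u v|]; first by rewrite /subst2 linearP.
by split=> [|u v]; rewrite /subst2 ?rmorph1 // rmorphM.
Qed.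

Lemma subst2x f g : subst2 f g x = f.
Proof. by rewrite /subst2 comp_mpolyXU. Qed.

Lemma subst2y f g : subst2 f g y = g.
Proof. by rewrite /subst2 comp_mpolyXU. Qed.

Lemma subst2D f g p q : subst2 f g (p + q) = subst2 f g p + subst2 f g q.
Proof. exact: comp_mpolyD. Qed.

Lemma subst2B f g p q : subst2 f g (p - q) = subst2 f g p - subst2 f g q.
Proof. exact: comp_mpolyB. Qed.

Lemma subst2Z f g c p : subst2 f g (c *: p) = c *: subst2 f g p.
Proof. exact: comp_mpolyZ. Qed.

Lemma subst2X f g p n : subst2 f g (p ^+ n) = subst2 f g p ^+ n.
Proof. by rewrite /subst2 rmorphXn. Qed.

Lemma subst2C f g c : subst2 f g c%:MP = c%:MP.
Proof. exact: comp_mpolyC. Qed.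

Definition subst2E := (subst2B, subst2D, subst2Z, subst2X, subst2C, subst2x, subst2y).

Lemma alg_auto_hom phi : alg_auto phi -> alg_hom phi.
Proof. by case. Qed.

Lemma alg_auto_subst2 f g f' g' :
  subst2 f g f' = x -> subst2 f g g' = y ->
  subst2 f' g' f = x -> subst2 f' g' g = y -> alg_auto (subst2 f g).
Proof.
move=> e1 e2 e3 e4; have [hL hM] := subst2_hom f g; split=> //.
have h := subst2_hom f g; have h' := subst2_hom f' g'.
exists (subst2 f' g') => p.
  apply: (alg_hom_ext (alg_hom_comp h' h) alg_hom_id) => /=; by rewrite ?subst2x ?subst2y.
apply: (alg_hom_ext (alg_hom_comp h h') alg_hom_id) => /=; by rewrite ?subst2x ?subst2y.
Qed.

Lemma alg_auto_comp phi psi : alg_auto phi -> alg_auto psi -> alg_auto (phi \o psi).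
Proof.
move=> aphi apsi.
have [hL hM] := alg_hom_comp (alg_auto_hom aphi) (alg_auto_hom apsi).
by split=> //; case: aphi apsi => _ _ b1 [_ _ b2]; apply: bij_comp.
Qed.

Definition aut_pair (fg : A2 * A2) : Prop := alg_auto (subst2 fg.1 fg.2).

Lemma alg_autoE phi : alg_auto phi -> phi = subst2 (phi x) (phi y).
Proof.
move=> aphi; apply/funext.
by apply: alg_hom_ext (alg_auto_hom aphi) (subst2_hom _ _) _ _; rewrite ?subst2x ?subst2y.
Qed.

Lemma aut_pair_comp f g u v : aut_pair (f, g) -> aut_pair (u, v) ->
  aut_pair (subst2 f g u, subst2 f g v).
Proof.
move=> afg auv; rewrite /aut_pair /=; have := alg_auto_comp afg auv => /= a.
by have := alg_autoE a; rewrite /= subst2x subst2y => <-.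
Qed.

Lemma aut_pairC f g : aut_pair (f, g) -> aut_pair (g, f).
Proof.
move=> afg; have := aut_pair_comp afg (_ : aut_pair (y, x)).
rewrite subst2x subst2y; apply.
by apply: (@alg_auto_subst2 _ _ y x); rewrite !subst2E.
Qed.

Lemma aut_pair_elementary f g c j : aut_pair (f, g) -> aut_pair (f + c *: g ^+ j, g).
Proof.
move=> afg; have := aut_pair_comp afg (_ : aut_pair (x + c *: y ^+ j, y)).
rewrite !subst2E; apply.
by apply: (@alg_auto_subst2 _ _ (x - c *: y ^+ j) y); rewrite !subst2E ?addrK ?subrK.
Qed.

(** Injectivity of the automorphism turns the relation into one between the two variables, whose
    coefficients can be compared. *)
Lemma aut_pair_independent f g c d e : aut_pair (f, g) ->
  c *: f + d *: g = e%:MP -> c = 0 /\ d = 0.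
Proof.
case=> _ _ [psi psiK _] rel.
have : subst2 f g (c *: x + d *: y) = subst2 f g e%:MP by rewrite !subst2E.
move/(can_inj psiK) => /mpolyP relx; split.
  have := relx U_(ord0)%MM; rewrite mcoeffD !mcoeffZ !mcoeffXU mcoeffC /=.
  by rewrite -mdeg_eq0 mdeg1 mulr1 !mulr0 addr0.
have := relx U_(ord_max)%MM; rewrite mcoeffD !mcoeffZ !mcoeffXU mcoeffC /=.
by rewrite -mdeg_eq0 mdeg1 mulr1 !mulr0 add0r.
Qed.

Lemma tdeg_aut_pair f g : aut_pair (f, g) -> (0 < tdeg g)%N.
Proof.
move=> afg; rewrite lt0n; apply/eqP => /tdeg_eq0 gE.
have rel : 0 *: f + 1 *: g = (g@_0)%:MP by rewrite scale0r scale1r add0r.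
by have [_ /eqP] := aut_pair_independent afg rel; rewrite oner_eq0.
Qed.

Lemma aut_pair_reduce f g : aut_pair (f, g) ->
  (tdeg g <= tdeg f)%N -> (1 < tdeg f)%N ->
  exists d c, [/\ tdeg f = (d * tdeg g)%N, c != 0
    & (tdeg (f - c *: g ^+ d) < tdeg f)%N].
Proof.
move=> afg; have dg := tdeg_aut_pair afg; move: (afg) => [phiL phiM [psi _ phiK]].
(* The inverse automorphism [psi] writes every [p], in particular each variable, as a polynomial in
   [f] and [g]. *)
have evE (p : A2) : eval2 (polyC \o polyC) (radial f) (radial g)
    (bipoly (psi p)) = radial p.
  have := radial_alg_hom (psi p) phiL phiM.
  by rewrite phiK subst2x subst2y.
have radx : radial x = 'X by rewrite /radial mmapX mmap1U.
have rady : radial y = 'X%:P * 'X by rewrite /radial mmapX mmap1U.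
rewrite -!pdeg_radial => lefg df; rewrite -pdeg_radial in dg.
have [d [c [dE c0 small]]] := leading_form_power_poly dg lefg df
  (size_coef0_radial f) (size_coef0_radial g) (etrans (evE x) radx)
  (etrans (evE y) rady).
exists d, c; split=> //; rewrite -pdeg_radial.
rewrite radialB radialZ radialX.
exact: small.
Qed.

End AutomorphismPairs.

(** * Counting automorphisms *)

Section FiniteCardinality.

Definition ncard (T : choiceType) (A : set T) : nat := #|` fset_set A|%fset.

Lemma ncard_seq (T : choiceType) (A : set T) (s : seq T) : uniq s ->
  (forall x, A x <-> x \in s) -> ncard A = size s.
Proof.
move=> us As; have finA : finite_set A.
  by rewrite (_ : A = [set` s]) //; apply/seteqP; split=> x /As.
apply: perm_size; apply: uniq_perm => // x.
rewrite in_fset_set //; apply/idP/idP; first by move/set_mem/As.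
by move/As/mem_set.
Qed.

Lemma ncard_set0 (T : choiceType) (A : set T) : A = set0 -> ncard A = 0%N.
Proof. by move=> ->; rewrite /ncard fset_set0 cardfs0. Qed.

Lemma ncard_image (T U : choiceType) (f : T -> U) (A : set T) (B : set U) :
  finite_set A -> set_bij A B f -> ncard B = ncard A.
Proof.
move=> finA [fAB injf surjf]; have BE : B = f @` A.
  by apply/seteqP; split=> [//|_ [x Ax <-]]; apply: fAB.
rewrite /ncard BE fset_set_image // card_in_imfset // => x y.
by rewrite /= !in_fset_set //; apply: injf.
Qed.

Lemma ncard_split (T : choiceType) (A B : set T) : finite_set A -> B `<=` A ->
  ncard A = (ncard B + ncard (A `\` B))%N.
Proof.
move=> finA BA; have finB := sub_finite_set BA finA.
have subBA : (fset_set B `<=` fset_set A)%fset by rewrite -fset_set_sub.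
by rewrite /ncard fset_setD // cardfsDS // subnKC // fsubset_leq_card.
Qed.

Lemma ncard_fibers (T : choiceType) (A : set T) (h : T -> nat) n : finite_set A ->
  (forall x, A x -> (h x < n)%N) ->
  ncard A = (\sum_(i < n) ncard [set x | A x /\ h x = i])%N.
Proof.
move=> finA hn; pose F i := [set x | A x /\ h x = i].
apply: etrans (esym (@trivIset_sum_card _ F n _ _)).
- congr (ncard _); rewrite -(bigcup_mkord n F); apply/seteqP; split=> [x Ax|x [i _ [Ax _]] //].
  by exists (h x) => //=; apply: hn.
- by move=> i; apply: sub_finite_set finA => x [].
- by move=> i j _ _ [x [[_ <-] [_ <-]]].
Qed.

Lemma ncard_finT (T : finType) : ncard [set: T] = #|T|.
Proof. by rewrite cardE; apply: ncard_seq; rewrite ?enum_uniq // => x; rewrite mem_enum. Qed.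

Lemma ncard_finTX (I : finType) (T : choiceType) (A : set T) : finite_set A ->
  ncard ([set: I] `*` A) = (#|I| * ncard A)%N.
Proof.
move=> finA; rewrite cardE -(size_allpairs pair).
apply: ncard_seq => [|[i x]].
  by rewrite allpairs_uniq ?enum_uniq //; move=> [? ?] [? ?].
split=> [[_ Ax]|/allpairsP[[j z] [_ zA [_ xz]]]].
  by apply/allpairsP; exists (i, x); rewrite mem_enum in_fset_set // mem_set.
by split=> //=; rewrite xz; move: zA; rewrite in_fset_set // => /set_mem.
Qed.

End FiniteCardinality.

Section CountingAutomorphisms.
Variable k : finFieldType.
Local Notation A2 := {mpoly k[2]}.
Local Notation x := ('X_ord0 : A2).
Local Notation y := ('X_ord_max : A2).
Implicit Types (p q f g u v : A2) (c : k) (fg : A2 * A2).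

Lemma finite_tdeg n : finite_set [set p : A2 | (tdeg p < n)%N].
Proof.
pose poly_of (a : {ffun 'X_{1..2 < n} -> k}) : A2 :=
  \sum_(m : 'X_{1..2 < n}) a m *: 'X_[m].
apply: (@sub_finite_set _ _ (poly_of @` [set: _])); last first.
  exact/finite_image/finite_finset.
move=> p /= ltp; exists [ffun m : 'X_{1..2 < n} => p@_m] => //.
rewrite /poly_of [RHS](@mpolywE _ _ n); last by move: ltp; rewrite /tdeg; lia.
by apply: eq_bigr => m _; rewrite ffunE.
Qed.

Lemma finite_tdeg_pair n (A : set (A2 * A2)) :
  (forall fg, A fg -> (tdeg fg.1 < n)%N /\ (tdeg fg.2 < n)%N) -> finite_set A.
Proof.
move=> An; apply: sub_finite_set (finite_setX (finite_tdeg n) (finite_tdeg n)).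
by move=> fg /An.
Qed.

Definition auts n : set (A2 * A2) :=
  [set fg | aut_pair fg /\ maxn (tdeg fg.1) (tdeg fg.2) = n].

(** The bound on the first component is a multiple of [m] because reduction by powers of the second
    one removes such multiples. *)
Definition auts_below m j : set (A2 * A2) :=
  [set fg | [/\ aut_pair fg, tdeg fg.2 = m & (tdeg fg.1 < j * m)%N]].

Lemma finite_auts n : finite_set (auts n).
Proof. by apply: (@finite_tdeg_pair n.+1) => fg [_ <-]; rewrite !ltnS leq_maxl leq_maxr. Qed.

Lemma finite_auts_below m j : finite_set (auts_below m j).
Proof.
apply: (@finite_tdeg_pair (m.+1 + j * m)) => fg [_ <- lt1].
by split; move: lt1; lia.
Qed.

Lemma num_autoE n : num_auto k n = ncard (auts n).
Proof.
apply: (ncard_image (f := fun fg => subst2 fg.1 fg.2)); first exact: finite_auts.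
split.
- by move=> fg [afg deg]; split=> //; rewrite /auto_deg subst2x subst2y.
- move=> [f g] [f' g'] _ _ /= eqfg.
  have := congr1 (fun phi => (phi x, phi y)) eqfg.
  by rewrite /= !subst2x !subst2y.
- move=> phi [aphi deg]; exists (phi x, phi y); last by rewrite -alg_autoE.
  by split=> //; rewrite /aut_pair /= -alg_autoE.
Qed.

(** Adding [c *: g ^+ j] to the first component is a bijection from pairs of a constant and an
    element of the smaller set. It is onto by Jung's reduction, and one-to-one because two different
    constants would make a difference of small components have degree [j * m]. *)
Lemma card_auts_belowS m j : (0 < m)%N -> (0 < j)%N -> (1 < j * m)%N ->
  ncard (auts_below m j.+1) = (#|k| * ncard (auts_below m j))%N.
Proof.
move=> m_gt0 j_gt0 jm_gt1; rewrite -ncard_finTX; last exact: finite_auts_below.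
apply: (ncard_image (f := fun cfg => (cfg.2.1 + cfg.1 *: cfg.2.2 ^+ j, cfg.2.2))).
  by apply: finite_setX; [exact: finite_finset|exact: finite_auts_below].
have tdeg_pow c g : c != 0 -> tdeg g = m -> tdeg (c *: g ^+ j) = (j * m)%N.
  move=> c0 dg; rewrite tdegZ // tdegX ?dg //.
  by apply: contraTneq m_gt0 => g0; rewrite -dg g0 tdeg0.
have tdeg_pow_lt c g : tdeg g = m -> (tdeg (c *: g ^+ j) < j.+1 * m)%N.
  move=> dg; have [->|c0] := eqVneq c 0; first by rewrite scale0r tdeg0 muln_gt0.
  by rewrite tdeg_pow // ltn_mul2r m_gt0 ltnSn.
split.
- move=> [c [f g]] [_ [/= afg dg df]]; split=> //=; first exact: aut_pair_elementary.
  have lt1 : (tdeg f < j.+1 * m)%N by rewrite (ltn_trans df) // ltn_mul2r m_gt0 ltnSn.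
  have := tdeg_pow_lt c g dg; move: lt1; case: (j.+1 * m)%N => // d.
  by rewrite !ltnS => lt1 lt2; apply: tdegD_le.
- move=> [c [f g]] [c' [f' g']] /set_mem[_ [/= afg dg df]] /set_mem[_ [/= _ _ df']].
  move=> eqp; have eqg : g = g' := congr1 snd eqp; subst g'.
  have eqf : f + c *: g ^+ j = f' + c' *: g ^+ j := congr1 fst eqp.
  suff cc : c = c' by rewrite cc in eqf *; rewrite (addIr (c' *: g ^+ j) eqf).
  apply/eqP; rewrite -subr_eq0; apply: contraT => cc.
  have := tdeg_pow _ g cc dg.
  have -> : (c - c') *: g ^+ j = f' - f.
    by rewrite scalerBl; apply/eqP; rewrite subr_eq addrAC eq_sym subr_eq -eqf addrC.
  have : (tdeg (f' - f) <= (j * m).-1)%N.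
    by apply: tdegD_le; rewrite ?tdegN; move: df df' jm_gt1; clear; lia.
  by move: jm_gt1; clear; lia.
- move=> [f g] [/= afg dg df].
  have [lt|le] := ltnP (tdeg f) (j * m).
    by exists (0, (f, g)); rewrite /= ?scale0r ?addr0.
  have le_gf : (tdeg g <= tdeg f)%N.
    by rewrite dg (leq_trans _ le) // leq_pmull.
  have [d [c [dE c0 small]]] := aut_pair_reduce afg le_gf (leq_trans jm_gt1 le).
  have dj : d = j.
    apply/eqP; move: df le; rewrite dE dg ltn_mul2r leq_mul2r m_gt0 ltnS eqn0Ngt m_gt0 /=.
    by rewrite eqn_leq => -> ->.
  exists (c, (f - c *: g ^+ j, g)); last by rewrite /= subrK.
  split=> //; split=> //=.
    by rewrite -scaleNr; apply: aut_pair_elementary.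
  by rewrite -dj; move: small; rewrite dE dg.
Qed.

(** The induction starts at 2: the step from 1 to 2 fails for [m = 1], as no component of an
    automorphism has degree 0. *)
Lemma card_auts_below_pow m j : (0 < m)%N ->
  ncard (auts_below m j.+2) = (#|k| ^ j * ncard (auts_below m 2))%N.
Proof.
move=> m_gt0; elim: j => [|j IHj]; first by rewrite mul1n.
rewrite card_auts_belowS //; last by rewrite mulSn mulSn; move: m_gt0; clear; lia.
by rewrite IHj mulnA -expnS.
Qed.

Lemma multiple_tdeg f g : aut_pair (f, g) -> (tdeg g <= tdeg f)%N ->
  (1 < tdeg f)%N -> (tdeg g %| tdeg f)%N.
Proof.
move=> afg le1 le2; have [d [c [-> _ _]]] := aut_pair_reduce afg le1 le2.
by rewrite dvdn_mull.
Qed.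

Lemma auts_below_subset m i j : (i <= j)%N -> auts_below m i `<=` auts_below m j.
Proof.
by move=> leij fg [afg dg df]; split=> //; rewrite (leq_trans df) // leq_mul2r leij orbT.
Qed.

(** Degrees strictly between [n] and [2 * n] are excluded, since a first component of degree above
    [n] has degree a multiple of [n]. *)
Lemma auts_below2 n fg : (0 < n)%N ->
  auts_below n 2 fg <-> auts n fg /\ tdeg fg.2 = n.
Proof.
case: fg => f g n_gt0; split=> [[/= afg dg df]|[[/= afg dfg] dg]]; last first.
  by split=> //=; have := leq_maxl (tdeg f) (tdeg g); rewrite dfg; move: n_gt0; clear; lia.
split=> //; split=> //=; rewrite dg; apply/maxn_idPr; rewrite leqNgt; apply/negP => ltn.
have gt1 : (1 < tdeg f)%N by apply: leq_ltn_trans ltn.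
have /dvdnP[d dE] : (n %| tdeg f)%N by rewrite -dg multiple_tdeg // dg ltnW.
move: df ltn; rewrite dE ltn_mul2r n_gt0 /= -{1}[n]mul1n ltn_mul2r n_gt0 /=.
by case: d {dE} => [|[|d]].
Qed.

(** When the second component is not of degree [n], the first one is and the second has smaller
    degree; exchanging them gives an element of [auts_below n 1]. *)
Lemma card_auts n : (1 < n)%N ->
  ncard (auts n) = (ncard (auts_below n 2) + ncard (auts_below n 1))%N.
Proof.
move=> n_gt1; have n_gt0 := ltnW n_gt1.
have sub : auts_below n 2 `<=` auts n by move=> fg /(auts_below2 fg n_gt0)[].
rewrite (ncard_split (finite_auts n) sub); congr (_ + _)%N.
apply: (ncard_image (f := fun fg => (fg.2, fg.1))); first exact: finite_auts_below.
split.
- move=> [f g] [/= afg dg df]; rewrite mul1n in df; split.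
    split; first exact: aut_pairC.
    by rewrite /= dg; apply/maxn_idPl/ltnW.
  by move/(auts_below2 _ n_gt0) => -[_ /= dfn]; rewrite dfn ltnn in df.
- move=> [f g] [f' g'] _ _ eqp.
  by rewrite (congr1 fst eqp : g = g') (congr1 snd eqp : f = f').
- move=> [f g] [[/= afg dfg] notB]; exists (g, f) => //.
  have ltg : (tdeg g < n)%N.
    rewrite ltn_neqAle -{2}dfg leq_maxr andbT; apply/eqP => dg.
    by apply: notB; apply/auts_below2.
  split=> /=; [exact: aut_pairC| |by rewrite mul1n].
  rewrite -dfg; apply/esym/maxn_idPl; rewrite leqNgt; apply/negP => /ltnW/maxn_idPr gE.
  by rewrite -dfg gE ltnn in ltg.
Qed.

(** Exchange the components and let n = d m. The larger one then has degree exactly d m, so the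
    pairs are those of [auts_below m (d + 1)] outside [auts_below m d], and their number is #|k| - 1
    times that of the latter. *)
Lemma card_auts_fiber m n : (0 < m)%N -> (m < n)%N ->
  ncard [set fg | auts_below n 1 fg /\ tdeg fg.1 = m] =
  (if m %| n then (#|k|).-1 * (#|k| ^ (n %/ m - 2) * ncard (auts_below m 2)) else 0)%N.
Proof.
move=> m_gt0 ltmn; have n_gt1 : (1 < n)%N by apply: leq_ltn_trans ltmn.
have dvd_mn f g : aut_pair (f, g) -> tdeg g = n -> tdeg f = m -> (m %| n)%N.
  move=> afg dg df; rewrite -dg -df.
  by apply: multiple_tdeg (aut_pairC afg) _ _; rewrite dg ?df // ltnW.
case: ifP => [/dvdnP[d nE]|ndvd]; last first.
  apply: ncard_set0; apply/seteqP; split=> // -[f g] [[/= afg dg _] df].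
  by rewrite (dvd_mn f g) in ndvd.
have d_gt1 : (1 < d)%N by move: ltmn; rewrite nE -{1}[m]mul1n ltn_mul2r m_gt0.
rewrite nE mulnK //; case: d d_gt1 nE => [|[|d]] // _ nE.
rewrite !subSS subn0 -card_auts_below_pow //.
have dm_gt1 : (1 < d.+2 * m)%N by rewrite -nE.
have := ncard_split (finite_auts_below m d.+3) (@auts_below_subset m _ _ (leqnSn d.+2)).
rewrite card_auts_belowS // => cntE.
have {cntE} -> : ((#|k|).-1 * ncard (auts_below m d.+2) =
    ncard (auts_below m d.+3 `\` auts_below m d.+2))%N.
  apply/eqP; rewrite -(eqn_add2l (ncard (auts_below m d.+2))) -cntE -mulSn prednK //.
  by apply/card_gt0P; exists 0.
apply: (ncard_image (f := fun fg => (fg.2, fg.1))).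
  exact: finite_setD (finite_auts_below _ _).
split.
- move=> [f g] [[/= afg dg df] notB]; split=> //=.
  have df' : tdeg f = (d.+2 * m)%N.
    have le : (d.+2 * m <= tdeg f)%N.
      by rewrite leqNgt; apply/negP => lt; apply: notB.
    have /dvdnP[e eE] : (m %| tdeg f)%N.
      rewrite -dg; apply: multiple_tdeg => //; last exact: leq_trans le.
      by rewrite dg; apply: leq_trans le; rewrite leq_pmull.
    move: df le; rewrite eE ltn_mul2r leq_mul2r m_gt0 eqn0Ngt m_gt0 /= ltnS.
    by move=> le1 le2; congr (_ * _)%N; apply/eqP; rewrite eqn_leq le1.
  by split=> /=; [exact: aut_pairC|rewrite df'|rewrite dg mul1n -nE].
- move=> [f g] [f' g'] _ _ eqp.
  by rewrite (congr1 fst eqp : g = g') (congr1 snd eqp : f = f').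
- move=> [f g] [[/= afg dg _] df]; exists (g, f) => //; split.
    by split=> /=; [exact: aut_pairC| |rewrite dg ltn_mul2r m_gt0 ltnSn].
  by case=> _ _ /=; rewrite dg ltnn.
Qed.

Lemma card_auts_below1 n : (1 < n)%N ->
  ncard (auts_below n 1) = (\sum_(m < n | m %| n)
    (#|k|).-1 * (#|k| ^ (n %/ m - 2) * ncard (auts_below m 2)))%N.
Proof.
move=> n_gt1; rewrite (ncard_fibers (h := fun fg => tdeg fg.1) (n := n)); last 2 first.
- exact: finite_auts_below.
- by move=> fg [_ _]; rewrite mul1n.
rewrite [RHS]big_mkcond; apply: eq_bigr => m _.
have [m0|m_gt0] := posnP m; last by rewrite card_auts_fiber.
rewrite m0 dvd0n -[n == _]negbK -lt0n (ltnW n_gt1) /=.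
apply: ncard_set0; apply/seteqP; split=> // -[f g] [[/= afg _ _] df].
by have := tdeg_aut_pair (aut_pairC afg); rewrite df.
Qed.

End CountingAutomorphisms.

(** * Automorphisms of degree 1 *)

Section AffineAutomorphisms.
Variable k : finFieldType.
Local Notation A2 := {mpoly k[2]}.
Local Notation x := ('X_ord0 : A2).
Local Notation y := ('X_ord_max : A2).
Implicit Types (p q f g u v : A2) (a b c : k).

Definition affine_form a b c : A2 := a *: x + b *: y + c%:MP.

Lemma mcoeff_affine_form a b c :
  [/\ (affine_form a b c)@_U_(ord0) = a, (affine_form a b c)@_U_(ord_max) = b
    & (affine_form a b c)@_0 = c].
Proof.
rewrite /affine_form !mcoeffD !mcoeffZ !mcoeffXU !mcoeffX !mcoeffC !mnm1_eq0 !eqxx /=.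
by split; ring.
Qed.

Lemma affine_form_inj a b c a' b' c' :
  affine_form a b c = affine_form a' b' c' -> [/\ a = a', b = b' & c = c'].
Proof.
have [e1 e2 e3] := mcoeff_affine_form a b c.
have [e1' e2' e3'] := mcoeff_affine_form a' b' c'.
by move=> eqf; split; [rewrite -e1 eqf e1'|rewrite -e2 eqf e2'|rewrite -e3 eqf e3'].
Qed.

Lemma tdeg_affine_form a b c : (tdeg (affine_form a b c) <= 1)%N.
Proof.
have tdeg_le e (i : 'I_2) : (tdeg (e *: 'X_i : A2) <= 1)%N.
  have [->|e0] := eqVneq e 0; first by rewrite scale0r tdeg0.
  by rewrite tdegZ // /tdeg msizeX mdeg1.
by rewrite !tdegD_le // /tdeg msizeC; case: eqP.
Qed.

Lemma mcoeff_gt_tdeg p (m : 'X_{1..2}) : (tdeg p < mdeg m)%N -> p@_m = 0.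
Proof.
move=> lt; apply/memN_msupp_eq0/msize_mdeg_ge.
by move: lt; rewrite /tdeg; case: (msize p).
Qed.

Lemma affine_formP p : (tdeg p <= 1)%N ->
  p = affine_form (p@_U_(ord0)) (p@_U_(ord_max)) (p@_0).
Proof.
move=> dp; set q := affine_form _ _ _.
have [q0 q1 q2] := mcoeff_affine_form p@_U_(ord0) p@_U_(ord_max) p@_0.
apply/mpolyP => m; have [m_gt1|] := ltnP 1 (mdeg m).
  by rewrite !mcoeff_gt_tdeg // (leq_ltn_trans _ m_gt1) // tdeg_affine_form.
rewrite leq_eqVlt ltnS leqn0 => /orP[/mdeg1P[i /eqP ->]|]; last first.
  by rewrite mdeg_eq0 => /eqP ->.
by case: i => [[|[|i]] lti] //.
Qed.

Lemma subst2_affine_form a1 b1 c1 a2 b2 c2 a b c :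
  subst2 (affine_form a1 b1 c1) (affine_form a2 b2 c2) (affine_form a b c)
  = affine_form (a * a1 + b * a2) (a * b1 + b * b2) (a * c1 + b * c2 + c).
Proof.
rewrite [in LHS]/affine_form !subst2E /affine_form.
rewrite !scalerDr !scalerDl !scalerA !mpolyCD -!mul_mpolyC !mpolyCM; ring.
Qed.

Lemma affine_formx : affine_form 1 0 0 = x.
Proof. by rewrite /affine_form scale1r scale0r mpolyC0 !addr0. Qed.

Lemma affine_formy : affine_form 0 1 0 = y.
Proof. by rewrite /affine_form scale1r scale0r mpolyC0 addr0 add0r. Qed.

Definition affine_pair (A : 'M[k]_2) (c : k * k) : A2 * A2 :=
  (affine_form (A ord0 ord0) (A ord0 ord_max) c.1,
   affine_form (A ord_max ord0) (A ord_max ord_max) c.2).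

Lemma sum_I2 (R : nmodType) (E : 'I_2 -> R) : \sum_i E i = E ord0 + E ord_max.
Proof. by rewrite big_ord_recr big_ord1 /=; congr (E _ + _); apply: val_inj. Qed.

Lemma aut_affine_pair A (c : k * k) : A \in unitmx -> aut_pair (affine_pair A c).
Proof.
move=> uA; pose B := invmx A.
have BA i j : B i ord0 * A ord0 j + B i ord_max * A ord_max j = (i == j)%:R.
  by have /matrixP/(_ i j) := mulVmx uA; rewrite !mxE sum_I2.
have AB i j : A i ord0 * B ord0 j + A i ord_max * B ord_max j = (i == j)%:R.
  by have /matrixP/(_ i j) := mulmxV uA; rewrite !mxE sum_I2.
case: c => c1 c2; rewrite /aut_pair /=.
pose c' i := - (B i ord0 * c1 + B i ord_max * c2).
have c'A i : A i ord0 * c' ord0 + A i ord_max * c' ord_max =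
    - ((i == ord0)%:R * c1 + (i == ord_max)%:R * c2).
  by rewrite -!AB /c'; ring.
apply: (@alg_auto_subst2 _ _ _
  (affine_form (B ord0 ord0) (B ord0 ord_max) (c' ord0))
  (affine_form (B ord_max ord0) (B ord_max ord_max) (c' ord_max)));
  rewrite subst2_affine_form.
- by rewrite !BA /c' subrr affine_formx.
- by rewrite !BA /c' subrr affine_formy.
- by rewrite !AB c'A /= mul1r mul0r addr0 addNr affine_formx.
- by rewrite !AB c'A /= mul1r mul0r add0r addNr affine_formy.
Qed.

(** A nonzero kernel vector of the matrix would give a linear relation between the two components
    modulo constants. *)
Lemma affine_pair_unit A (c : k * k) : aut_pair (affine_pair A c) -> A \in unitmx.
Proof.
move=> aA; rewrite -row_free_unit -kermx_eq0; apply: contraT => /rowV0Pn[v vA v0].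
have {vA}vA j : v ord0 ord0 * A ord0 j + v ord0 ord_max * A ord_max j = 0.
  by have /sub_kermxP/matrixP/(_ ord0 j) := vA; rewrite !mxE sum_I2.
have [] := @aut_pair_independent _ _ _ (v ord0 ord0) (v ord0 ord_max)
  (v ord0 ord0 * c.1 + v ord0 ord_max * c.2) aA.
  transitivity (affine_form 0 0 (v ord0 ord0 * c.1 + v ord0 ord_max * c.2)).
    have := subst2_affine_form (A ord0 ord0) (A ord0 ord_max) c.1
      (A ord_max ord0) (A ord_max ord_max) c.2 (v ord0 ord0) (v ord0 ord_max) 0.
    by rewrite !vA addr0 => <-; rewrite {3}/affine_form !subst2E mpolyC0 addr0.
  by rewrite /affine_form !scale0r !add0r.
move=> v00 v01; case/eqP: v0; apply/rowP => j; rewrite mxE.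
by case: j => [[|[|j]] ltj] //; [rewrite -[RHS]v00|rewrite -[RHS]v01];
  congr (v _ _); apply: val_inj.
Qed.

(** These are the affine automorphisms: an invertible matrix and a translation vector, whence
    [#|k| ^ 2] times the order of GL_2. *)
Lemma card_auts1 : ncard (@auts_below k 1 2) = (#|k| ^ 3 * (#|k|).-1 ^ 2 * (#|k|).+1)%N.
Proof.
transitivity #|{: {'GL_2[k]} * (k * k)}|; last first.
  rewrite !card_prod -[#|{: {'GL_2[k]}}|]cardsT -[[set: _]%SET]/('GL_2[k]%g) card_GL_2.
  by ring.
rewrite -ncard_finT.
apply: (ncard_image (f := fun uc : {'GL_2[k]} * (k * k) => affine_pair (val uc.1) uc.2)).
  exact: finite_finset.
split.
- move=> [u c] _ /=; have aA := aut_affine_pair c (GL_unitmx u).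
  split=> //; last by rewrite mul2n ltnS tdeg_affine_form.
  by apply/eqP; rewrite eqn_leq tdeg_affine_form (tdeg_aut_pair aA).
- move=> [u [c1 c2]] [u' [c1' c2']] _ _ eqp.
  have [e00 e01 /= ->] := affine_form_inj (congr1 fst eqp).
  have [e10 e11 /= ->] := affine_form_inj (congr1 snd eqp).
  congr (_, _); apply: val_inj; apply/matrixP => i j.
  have ord2 (l : 'I_2) : l = ord0 \/ l = ord_max.
    by case: l => [[|[|l]] ltl] //; [left|right]; apply: val_inj.
  by case: (ord2 i) => ->; case: (ord2 j) => ->.
- move=> [f g] [/= afg dg df]; rewrite ltnS in df.
  pose A : 'M[k]_2 := \matrix_(i, j) (if i == ord0 then f@_U_(j) else g@_U_(j)).
  have AE : affine_pair A (f@_0, g@_0) = (f, g).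
    by rewrite /affine_pair !mxE /= -!affine_formP // dg.
  have uA : A \in unitmx by apply: (@affine_pair_unit _ (f@_0, g@_0)); rewrite AE.
  by exists (Sub A uA, (f@_0, g@_0)).
Qed.

End AffineAutomorphisms.

(** * Ordered factorizations and Dirichlet series *)

Section OrderedFactorizations.

(* [fuel >= n] suffices; the head of a factorization is written [n %/ m]. *)
Fixpoint factorizations (fuel n : nat) : seq (seq nat) :=
  if n == 1%N then [:: [::]] else
  if fuel is fuel'.+1 then
    [seq (n %/ m)%N :: s | m <- [seq m <- iota 0 n | (m %| n)%N],
                           s <- factorizations fuel' m]
  else [::].

Lemma proper_divisorP m n : (0 < n)%N ->
  (m \in [seq m <- iota 0 n | (m %| n)%N]) = (0 < m)%N && (m < n)%N && (m %| n)%N.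
Proof.
move=> n_gt0; rewrite mem_filter mem_iota add0n /= andbC.
case: (boolP (m %| n)%N) => [mn|_]; last by rewrite !andbF.
by rewrite (dvdn_gt0 n_gt0 mn).
Qed.

Lemma mem_factorizations fuel n s : (0 < n)%N -> (n <= fuel)%N ->
  (s \in factorizations fuel n) =
  all (fun m => 1 < m)%N s && ((\prod_(m <- s) m)%N == n).
Proof.
elim: fuel n s => [|fuel IH] n s n_gt0 len; first by move: n_gt0 len; case: n.
have [n1|n1] := eqVneq n 1%N.
  rewrite /= n1 eqxx inE; case: s => [|a s]; first by rewrite big_nil.
  rewrite big_cons muln_eq1 /=; case: (eqVneq a 1%N) => [->|] //=.
  by rewrite andbF.
rewrite [factorizations _ _]/= (negPf n1); apply/allpairsPdep/idP.
  move=> [m [t [mn tm ->]]]; move: mn; rewrite proper_divisorP // => /andP[/andP[m0 ltmn] mn].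
  have lem : (m <= fuel)%N by rewrite -ltnS (leq_trans ltmn).
  move: tm; rewrite IH // => /andP[allt /eqP prodt].
  by rewrite /= big_cons prodt allt divnK // eqxx ltn_divRL // mul1n ltmn.
case: s => [|a s]; first by rewrite big_nil eq_sym (negPf n1).
rewrite big_cons /= => /andP[/andP[a1 alls] /eqP prodE].
set m := (\prod_(_ <- s) _)%N in prodE.
have m0 : (0 < m)%N by rewrite lt0n; apply: contraTneq n_gt0 => m0; rewrite -prodE m0 muln0.
have ltmn : (m < n)%N by rewrite -prodE ltn_Pmull.
exists m, s; split.
- by rewrite proper_divisorP // m0 ltmn -prodE dvdn_mull.
- by rewrite IH ?alls ?eqxx // -ltnS (leq_trans ltmn).
- by rewrite -prodE mulnK.
Qed.

Lemma uniq_factorizations fuel n : (0 < n)%N -> (n <= fuel)%N ->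
  uniq (factorizations fuel n).
Proof.
elim: fuel n => [|fuel IH] n n_gt0 len; first by move: n_gt0 len; case: n.
rewrite /=; case: eqP => // _; apply: allpairs_uniq_dep.
- by rewrite filter_uniq ?iota_uniq.
- move=> m; rewrite proper_divisorP // => /andP[/andP[m0 ltmn] _].
  by apply: IH => //; rewrite -ltnS (leq_trans ltmn).
move=> _ _ /allpairsPdep[m [s [mn sm ->]]] /allpairsPdep[m' [s' [mn' sm' ->]]] /=.
case=> _ ss; subst s'; suff mm : m = m' by rewrite mm.
(* The divisor [m] attached to a tail is recovered as the product of that tail. *)
have prodE m1 : m1 \in [seq m1 <- iota 0 n | (m1 %| n)%N] ->
    s \in factorizations fuel m1 -> (\prod_(i <- s) i)%N = m1.
  rewrite proper_divisorP // => /andP[/andP[m0 ltmn] _].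
  have lem : (m1 <= fuel)%N by rewrite -ltnS (leq_trans ltmn).
  by rewrite mem_factorizations // => /andP[_ /eqP].
by rewrite -(prodE m) // -(prodE m').
Qed.

(** Splitting off the first factor [n %/ m] reproduces the recurrence of [b]; the empty
    factorization of 1 accounts for [b 1]. *)
Lemma sum_factorizations (c q : rat) (b : nat -> rat) : b 1%N = 1 ->
  (forall n, (1 < n)%N ->
     b n = \sum_(m < n | (m %| n)%N) c * q ^+ (n %/ m) * b m) ->
  forall fuel n, (0 < n)%N -> (n <= fuel)%N ->
  \sum_(s <- factorizations fuel n) c ^+ size s * q ^+ sumn s = b n.
Proof.
move=> b1 brec; elim=> [|fuel IH] n n_gt0 len; first by move: n_gt0 len; case: n.
rewrite /=; have [->|n1] := eqVneq n 1%N; first by rewrite big_seq1 mulr1 b1.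
rewrite big_allpairs_dep brec; last by rewrite ltn_neqAle eq_sym n1.
rewrite -(big_mkord (fun m => m %| n)%N (fun m => c * q ^+ (n %/ m) * b m)).
rewrite -[RHS]big_filter /index_iota subn0; apply: eq_big_seq => m.
rewrite proper_divisorP // => /andP[/andP[m0 ltmn] _].
have lem : (m <= fuel)%N by rewrite -ltnS (leq_trans ltmn).
rewrite -(IH m) // mulr_sumr; apply: eq_bigr => s _.
by rewrite /= exprS exprD; ring.
Qed.

Lemma fsum_ordered_factorizations (c q : rat) (b : nat -> rat) : b 1%N = 1 ->
  (forall n, (1 < n)%N ->
     b n = \sum_(m < n | (m %| n)%N) c * q ^+ (n %/ m) * b m) ->
  forall n, (1 < n)%N ->
  \sum_(s \in ordered_factorizations n) c ^+ size s * q ^+ sumn s = b n.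
Proof.
move=> b1 brec n n_gt1; have n_gt0 := ltnW n_gt1.
have -> : ordered_factorizations n = [set` factorizations n n].
  apply/seteqP; split=> s /=; rewrite mem_factorizations //.
    by move=> [_ alls ->]; rewrite alls eqxx.
  move=> /andP[alls /eqP prodE]; split=> //; apply: contraTneq n_gt1 => s0.
  by rewrite -prodE s0 big_nil.
by rewrite -fsbig_seq ?uniq_factorizations // (sum_factorizations b1 brec).
Qed.

End OrderedFactorizations.

(** * Dirichlet convolution as a sum over divisors *)

Section DirichletProduct.

Lemma dmul_divisors (a b : dirichlet) n : (0 < n)%N ->
  (a * b) n = \sum_(m < n.+1 | (m %| n)%N) a m * b (n %/ m)%N.
Proof.
move=> n_gt0; rewrite [(_ * _)]/(dmul a b) dmulE // [RHS]big_mkcond; apply: eq_bigr => m _.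
have [mn|/negP ndvd] := boolP (m %| n)%N; last first.
  rewrite big1 // => j /eqP mj; case: ndvd; apply/dvdnP.
  by exists (nat_of_ord j); rewrite mulnC.
have m_gt0 := dvdn_gt0 n_gt0 mn.
have ltd : (n %/ m < n.+1)%N by rewrite ltnS leq_div.
rewrite (big_pred1 (Ordinal ltd)) // => j /=.
apply/eqP/eqP => [mj|->]; last by rewrite /= mulnC divnK.
by apply/val_inj/eqP => /=; rewrite -(eqn_pmul2l m_gt0) mj mulnC divnK.
Qed.

Lemma dconst_mul c (a : dirichlet) : dconst c * a = dseries (fun n => c * a n).
Proof.
apply/dirichletP => n n_gt0; rewrite dmul_divisors // dseriesE //.
have lt1 : (1 < n.+1)%N by [].
rewrite (bigD1 (Ordinal lt1)) ?dvd1n // big1 ?addr0 => [|m /andP[mn m1]].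
  by rewrite /= divn1 addr0.
rewrite -val_eqE /= in m1.
by rewrite [dconst c m]dseriesE ?(dvdn_gt0 n_gt0) // (negPf m1) mul0r.
Qed.

(** The recurrence says that the product of the series with [1 - dconst c * rho q] has zero
    coefficients beyond the first. *)
Lemma dseries_rec (K c q : rat) (a : nat -> rat) : a 1%N = K ->
  (forall n, (1 < n)%N ->
     a n = \sum_(m < n | (m %| n)%N) c * q ^+ (n %/ m) * a m) ->
  dseries a = dconst K * (1 - dconst c * rho q)^-1.
Proof.
move=> a1 arec; apply: (canRL (mulrK (sub_rho_unit c q))).
rewrite mulrBr mulr1; apply/dirichletP => n n_gt0.
rewrite [(_ - _)]/(dadd _ (dopp _)) daddE dseriesE // [dopp _ _]dseriesE //.
rewrite dmul_divisors // dconst_mul [dconst K n]dseriesE //.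
(* The term [m = n] drops out because [rho] has coefficient 0 at 1. *)
rewrite big_mkcond big_ord_recr /= divnn n_gt0 dvdnn /= mulr0 mulr0 addr0 -big_mkcond /=.
have [n1|n1] := eqVneq n 1%N.
  by rewrite n1 big_mkcond big_ord1 dvd0n /= subr0.
rewrite arec; last by rewrite ltn_neqAle eq_sym n1.
apply/eqP; rewrite subr_eq0; apply/eqP; apply: eq_bigr => m mn.
have m_gt0 := dvdn_gt0 n_gt0 mn.
have lt1 : (1 < n %/ m)%N by rewrite ltn_divRL // mul1n.
have funE b i : (0 < i)%N -> dseries_fun b i = b i by case: i.
by rewrite !funE ?(ltnW lt1) // lt1; ring.
Qed.

End DirichletProduct.

(** * The recurrence for the numbers of automorphisms *)

Section Recurrence.
Variable F : finFieldType.
Local Notation q := (#|F|%:R : rat).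
Local Notation K := ((q * (q - 1) * (q + 1)) ^+ 2).

Let q_gt1 : (1 < #|F|)%N := card_finNzRing_gt1 F.
Let q0 : q != 0. Proof. by rewrite pnatr_eq0 -lt0n ltnW. Qed.
Let q1 : q + 1 != 0. Proof. by rewrite natr1 pnatr_eq0. Qed.
Let predq : (#|F|.-1)%:R = q - 1 :> rat.
Proof. by rewrite -subn1 natrB // ltnW. Qed.

(* Correcting [num_auto F 1] to [K] makes the recurrence uniform. *)
Definition corrected_num_auto (n : nat) : rat :=
  if n == 1%N then K else (num_auto F n)%:R.

Lemma num_auto1 : (num_auto F 1)%:R = q ^+ 3 * (q - 1) ^+ 2 * (q + 1).
Proof.
rewrite num_autoE; have -> : @auts F 1 = @auts_below F 1 2.
  apply/seteqP; split=> fg; last by case/(auts_below2 _ (ltn0Sn 0)).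
  move=> afg; apply/(auts_below2 _ (ltn0Sn 0)); split=> //.
  case: fg afg => f g [/= afg dfg]; apply/eqP.
  by rewrite eqn_leq (tdeg_aut_pair afg) andbT -dfg leq_maxr.
by rewrite card_auts1 2!natrM !natrX predq -natr1.
Qed.

Lemma num_auto_gt1 n : (1 < n)%N ->
  num_auto F n = (#|F|.+1 * ncard (@auts_below F n 1))%N.
Proof.
move=> n_gt1; rewrite num_autoE card_auts // card_auts_belowS ?mul1n //; last exact: ltnW.
by rewrite mulSn addnC.
Qed.

(** For [n > 1] the two counts are q and q + 1 times that of [auts_below n 1]; the value [K] at 1 is
    the one that gives the affine automorphisms the same ratio. *)
Lemma card_auts_below2E n : (0 < n)%N ->
  (ncard (@auts_below F n 2))%:R = q / (q + 1) * corrected_num_auto n.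
Proof.
move=> n_gt0; rewrite /corrected_num_auto; case: eqP => [->|/eqP n1].
  rewrite card_auts1 2!natrM !natrX predq -natr1; field; exact: q1.
have n_gt1 : (1 < n)%N by rewrite ltn_neqAle eq_sym n1.
rewrite num_auto_gt1 // card_auts_belowS ?mul1n // !natrM -natr1; field; exact: q1.
Qed.

(** The factors (q + 1), (q - 1) q^(n/m - 2) and q / (q + 1) multiply to (q - 1)/q times q^(n/m). *)
Lemma corrected_num_auto_rec n : (1 < n)%N ->
  corrected_num_auto n = \sum_(m < n | (m %| n)%N)
    (q - 1) / q * q ^+ (n %/ m) * corrected_num_auto m.
Proof.
move=> n_gt1; rewrite {1}/corrected_num_auto gtn_eqF // num_auto_gt1 // natrM.
rewrite card_auts_below1 // natr_sum mulr_sumr; apply: eq_bigr => m mn.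
have m_gt0 := dvdn_gt0 (ltnW n_gt1) mn.
rewrite !natrM natrX predq card_auts_below2E // -natr1.
have lt1 : (1 < n %/ m)%N by rewrite ltn_divRL // mul1n.
rewrite -[in RHS](subnK lt1) exprD; field.
by rewrite q0 q1.
Qed.

End Recurrence.

Theorem theorem2p1 (F : finFieldType) (q : rat) (hq : q = #|F|%:R) :
  [/\ (num_auto F 1)%:R = q ^+ 3 * (q - 1) ^+ 2 * (q + 1),
      forall n : nat, (1 < n)%N ->
        (num_auto F n)%:R =
          (q * (q - 1) * (q + 1)) ^+ 2 *
          \sum_(s \in ordered_factorizations n)
             (((q - 1) / q) ^+ size s * q ^+ sumn s)
    & p_series F =
        dconst ((q * (q - 1) * (q + 1)) ^+ 2) *
        ((1 - dconst ((q - 1) / q) * rho q)^-1 - dconst (1 / (q + 1))) ].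
Proof.
rewrite hq; set K := (_ * _ * _) ^+ 2.
have q_gt1 := card_finNzRing_gt1 F.
have q0 : #|F|%:R != 0 :> rat by rewrite pnatr_eq0 -lt0n ltnW.
have q1 : #|F|%:R + 1 != 0 :> rat by rewrite natr1 pnatr_eq0.
have K0 : K != 0.
  by rewrite expf_neq0 // !mulf_neq0 // subr_eq0 (eqr_nat _ _ 1) gtn_eqF.
split; first exact: num_auto1.
- move=> n n_gt1.
  have -> : (num_auto F n)%:R = corrected_num_auto F n.
    by rewrite /corrected_num_auto gtn_eqF.
  (* Division by [K] normalizes the value at 1 to 1, the contribution of the empty factorization. *)
  pose b n := corrected_num_auto F n / K.
  rewrite (@fsum_ordered_factorizations _ _ b) //.
  + by rewrite /b mulrC divfK.
  + by rewrite /b /corrected_num_auto eqxx divff.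
  + move=> m m_gt1; rewrite {1}/b corrected_num_auto_rec // mulr_suml.
    by apply: eq_bigr => i _; rewrite mulrA.
- rewrite mulrBr -(@dseries_rec K _ _ (corrected_num_auto F)) //; last first.
    exact: corrected_num_auto_rec.
  apply/dirichletP => n n_gt0; rewrite dconst_mul.
  rewrite [(_ - _)]/(dadd _ (dopp _)) daddE [dopp _ _]dseriesE // !dseriesE //.
  (* The subtracted constant undoes the correction at 1: K - K / (q + 1) is the number of affine
     automorphisms. *)
  rewrite /corrected_num_auto; case: eqP => [->|_]; last by rewrite mulr0 subr0.
  by rewrite num_auto1 /K; field; exact: q1.
Qed.
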